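(* Let $\mathcal U=\{u_1,\dots,u_c\}$ be an orthonormal basis of $\mathbb C^c$ and $U=(u_1,\dots,u_c)$ the corresponding unitary matrix. Assume that all data matrices $D_i$, $i\in\mathcal V$, become diagonal in the same basis $\mathcal U$, i.e. $$D_i=U\operatorname{Diag}(\lambda_i)U^*,\qquad\lambda_i\in\mathbb R^c,\quad i\in\mathcal V.$$ Then the solution of the quantum state assignment flow $$\dot\mu=\mathfrak R_\mu\big[\Omega[\mu]\big],\qquad\mu(0)=S(\mathbb 1_{\mathcal Q_c}),$$ is given by $$\mu_i(t)=U\operatorname{Diag}\big(S_i(t)\big)U^*,\qquad i\in\mathcal V,$$ where $S(t)\in\mathcal W_c$ satisfies the ordinary assignment flow equation $$\dot S=R_S[\Omega S],\qquad S(0)=S(\mathbb 1_{\mathcal W_c}),$$ and the initial point $S(\mathbb 1_{\mathcal W_c})$ is the classical similarity map evaluated at the barycenter $W=\mathbb 1_{\mathcal W_c}$ with the vectors $\lambda_i$, $i\in\mathcal V$, as data points.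
   Context: Fix $c\in\mathbb N$. $\mathcal H_c=\{X\in\mathbb C^{c\times c}: X^*=X\}$, $\mathcal D_c=\{\rho\in\mathcal H_c:\rho\succ0,\operatorname{tr}\rho=1\}$, $\langle A,B\rangle=\operatorname{tr}(AB)$ for matrices. For $\rho\in\mathcal D_c$, $X\in\mathcal H_c$: $\mathfrak R_\rho[X]=\mathbb T_\rho^{-1}[X]-\langle\rho,X\rangle\rho$ with $\mathbb T_\rho^{-1}[X]=\int_0^1\rho^{1-\lambda}X\rho^\lambda d\lambda$. Graph: $\mathcal G=(\mathcal V,\mathcal E,\omega)$ is a finite weighted graph, $\mathcal N_i=\{i\}\cup\{k\in\mathcal V: ik\in\mathcal E\}$, $\omega_{ik}\ge0$, $\omega_{ik}=0$ if $k\notin\mathcal N_i$, $\sum_{k\in\mathcal N_i}\omega_{ik}=1$, $\omega_{ij}=\omega_{ji}$ and $j\in\mathcal N_i\Leftrightarrow i\in\mathcal N_j$ for all $i,j\in\mathcal V$. Quantum objects: $\mathcal Q_c=\prod_{i\in\mathcal V}\mathcal D_c$, $\mathbb 1_{\mathcal Q_c}=(\frac1cI_c)_{i\in\mathcal V}$, $\Omega[\mu]_i=\sum_{k\in\mathcal N_i}\omega_{ik}\mu_k$, $\mathfrak R_\mu[X]_i=\mathfrak R_{\mu_i}[X_i]$. For data matrices $D_i\in\mathcal H_c$ the (quantum) similarity map is $S_i(\rho)=\Gamma\big(\sum_{k\in\mathcal N_i}\omega_{ik}(\log_{\mathrm m}\rho_k-D_k)\big)$, $\rho\in\mathcal Q_c$,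 with $\Gamma(X)=\exp_{\mathrm m}(X)/\operatorname{tr}\exp_{\mathrm m}(X)$ ($\exp_{\mathrm m},\log_{\mathrm m}$ matrix exponential and logarithm). Classical objects: $\mathcal S_c=\{p\in\mathbb R^c: p_j>0,\sum_jp_j=1\}$, $T_{c,0}=\{v\in\mathbb R^c:\sum_jv_j=0\}$, $\pi_{c,0}v=v-\frac1c(\sum_jv_j)(1,\dots,1)^\top$. $\mathcal W_c=\prod_{i\in\mathcal V}\mathcal S_c$, elements being row-stochastic matrices with rows in $\mathcal S_c$; $\mathbb 1_{\mathcal W_c}$ has all rows equal to $\frac1c(1,\dots,1)^\top$. $\Omega$ also denotes the matrix $(\omega_{ik})_{i,k\in\mathcal V}$, so $(\Omega S)_i=\sum_{k\in\mathcal N_i}\omega_{ik}S_k$. $R_p=\operatorname{Diag}(p)-pp^\top$, $R_S[\Omega S]_i=R_{S_i}(\Omega S)_i$. With componentwise products, quotients and exponentials, $\mathrm{Exp}_p(v)=\frac{p\cdot e^{v/p}}{\langle p,e^{v/p}\rangle}$ for $p\in\mathcal S_c$, $v\in T_{c,0}$ (a bijection $T_{c,0}\to\mathcal S_c$ for each $p$), $\exp_p(v)=\mathrm{Exp}_p(R_pv)=\frac{p\cdot e^v}{\langle p,e^v\rangle}$, and $L_p(\lambda)=\exp_p(-\pi_{c,0}\lambda)$ for $\lambda\in\mathbb R^c$. The classical similarity map with data $\lambda_i$ is $S_i(W)=\mathrm{Exp}_{W_i}\big(\sum_{k\in\mathcal N_i}\omega_{ik}\mathrm{Exp}_{W_i}^{-1}(L_{W_k}(\lambda_k))\big)$,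 $W\in\mathcal W_c$, $i\in\mathcal V$. *)

(* Defs.v *)
From HB Require Import structures.
From mathcomp Require Export all_boot all_order all_algebra.
From mathcomp Require Export sesquilinear spectral complex.
From mathcomp Require Export all_classical all_reals all_analysis.
Export numFieldNormedType.Exports.

Set Implicit Arguments.
Unset Strict Implicit.
Unset Printing Implicit Defensive.

Import Order.TTheory GRing.Theory Num.Theory.
Local Open Scope classical_set_scope.
Local Open Scope complex_scope.
Local Open Scope sesquilinear_scope.
Local Open Scope ring_scope.

Record weighted_graph (R : realType) (V : finType) := WeightedGraph {
  edge : rel V ;
  weight : V -> V -> R ;
  edge_sym : symmetric edge ;
  weight_ge0 : forall i k, 0 <= weight i k ;
  weight_out : forall i k, ~~ ((k == i) || edge i k) -> weight i k = 0 ;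
  weight_sum : forall i, \sum_(k | (k == i) || edge i k) weight i k = 1 ;
  weight_sym : forall i k, weight i k = weight k i }.

Definition nbhd (R : realType) (V : finType) (G : weighted_graph R V) (i : V) :
  {set V} := [set k | (k == i) || edge G i k].

(* Derivative relative to [0, +oo[: two-sided for t > 0, from the right at 0. *)
Definition deriv_ge0 (R : realType) (f : R -> R) (t l : R) : Prop :=
  (f s - f t) / (s - t) @[s --> within [set s : R | 0 <= s] (t^')] --> l.

Section ComplexMatrices.
Variables (R : realType) (c : nat).
Implicit Types (A X rho : 'M[R[i]]_c) (f : R -> R) (p : 'rV[R]_c).

Definition posdefmx A : Prop :=
  A \is hermsymmx /\
  forall v : 'cV[R[i]]_c, v != 0 -> 0 < (v ^t* *m A *m v) 0 0.

Definition density_matrix rho : Prop := posdefmx rho /\ \tr rho = 1.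

Definition inner A X : R[i] := \tr (A *m X).

Definition cdiag p : 'M[R[i]]_c := diag_mx (map_mx (real_complex R) p).

Definition expm A : 'M[R[i]]_c :=
  let S a b n := (\sum_(k < n) (k`!%:R)^-1 *: A ^+ k) a b in
  \matrix_(a, b) (limn (fun n => complex.Re (S a b n)) +i*
                  limn (fun n => complex.Im (S a b n))).

(* Functional calculus of a Hermitian matrix through its spectral
   decomposition A = P^-1 Diag(x) P, with P unitary and x real. *)
Definition hfun f A : 'M[R[i]]_c :=
  invmx (spectralmx A)
    *m cdiag (map_mx (fun z => f (complex.Re z)) (spectral_diag A))
    *m spectralmx A.

Definition logm A : 'M[R[i]]_c := hfun (@ln R) A.

Definition powm A (x : R) : 'M[R[i]]_c := hfun (fun y => y `^ x) A.

Definition Tinv rho X : 'M[R[i]]_c :=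
  let F a b (l : R) := (powm rho (1 - l) *m X *m powm rho l) a b in
  \matrix_(a, b)
    (Rintegral lebesgue_measure `[0, 1] (fun l => complex.Re (F a b l)) +i*
     Rintegral lebesgue_measure `[0, 1] (fun l => complex.Im (F a b l))).

Definition qreplicator rho X : 'M[R[i]]_c := Tinv rho X - inner rho X *: rho.

Definition qsoftmax X : 'M[R[i]]_c := (\tr (expm X))^-1 *: expm X.

(* hfun does not depend on the spectral decomposition. *)
Lemma hfun_diag (U : 'M[R[i]]_c) p f : U \is unitarymx ->
  hfun f (U *m cdiag p *m U ^t*) =
  U *m cdiag (map_mx f p) *m U ^t*.
Proof.
move=> Uu; set A := _ *m _ *m _.
have UtU : U ^t* *m U = 1%:M by rewrite -invmx_unitary // mulVmx ?unitarymx_unit.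
have cdC q : (cdiag q) ^t* = cdiag q.
  apply/matrixP => a b; rewrite !mxE eq_sym; have [->|//] := eqVneq a b.
    by rewrite !mulr1n /= /real_complex_def; congr (_ +i* _); rewrite oppr0.
  by rewrite !mulr0n rmorph0.
have Ah : A ^t* = A.
  by rewrite /A !(trmx_mul, map_mxM) trmxCK cdC mulmxA.
have hA : A \is hermsymmx.
  by apply/is_hermitianmxP; rewrite expr0 scale1r Ah.
have nA := hermitian_normalmx hA.
have := orthomx_spectralP nA.
set P := spectralmx A; set x := spectral_diag A => AE.
have Pu : P \in unitmx by apply: spectral_unit.
set q := map_mx (@complex.Re R) x.
have xE : x = map_mx (real_complex R) q.
  have /mxOverP xr := hermitian_spectral_diag_real hA.
  apply/rowP => j; rewrite !mxE; have := xr 0 j.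
  by rewrite -/x => /RRe_real.
pose W := P *m U.
have qW : cdiag q *m W = W *m cdiag p.
  rewrite /W mulmxA -[cdiag q *m P]mul1mx -(mulmxV Pu) -!mulmxA.
  have -> : invmx P *m (cdiag q *m (P *m U)) = A *m U.
    by rewrite AE xE !mulmxA.
  by rewrite /A -!mulmxA UtU mulmx1.
have fqW : cdiag (map_mx f q) *m W = W *m cdiag (map_mx f p).
  apply/matrixP => a b; have := congr1 (fun M : 'M[R[i]]_c => M a b) qW.
  rewrite !mul_diag_mx !mul_mx_diag !mxE.
  set w := (\sum_k _) => e.
  have [->|w0] := eqVneq w 0; first by rewrite mulr0 mul0r.
  move: e; rewrite mulrC => /(mulfI w0)/complexI ->; exact: mulrC.
rewrite /hfun -/P -/x.
have -> : map_mx (fun z => f (complex.Re z)) x = map_mx f q.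
  by apply/rowP => j; rewrite !mxE.
have -> : invmx P *m cdiag (map_mx f q) *m P
        = invmx P *m (cdiag (map_mx f q) *m W) *m U ^t*.
  by rewrite /W !mulmxA -(mulmxA _ U) -invmx_unitary // mulmxV ?mulmx1
    ?unitarymx_unit.
by rewrite fqW /W !mulmxA mulVmx // mul1mx.
Qed.

End ComplexMatrices.

Section Quantum.
Variables (R : realType) (V : finType) (G : weighted_graph R V) (c : nat).
Implicit Types (mu D : V -> 'M[R[i]]_c).

Definition qmanifold mu : Prop := forall i, density_matrix (mu i).

Definition qbarycenter : V -> 'M[R[i]]_c := fun=> (c%:R^-1)%:M.

Definition qOmega mu (i : V) : 'M[R[i]]_c :=
  \sum_(k in nbhd G i) (weight G i k)%:C *: mu k.

Definition qsimilarity D mu (i : V) : 'M[R[i]]_c :=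
  qsoftmax (\sum_(k in nbhd G i) (weight G i k)%:C *: (logm (mu k) - D k)).

Definition qsaf_solution D (mu : R -> V -> 'M[R[i]]_c) : Prop :=
  (forall t : R, 0 <= t ->
     qmanifold (mu t) /\
     forall i a b,
       let F := qreplicator (mu t i) (qOmega (mu t) i) in
       deriv_ge0 (fun s => complex.Re (mu s i a b)) t (complex.Re (F a b)) /\
       deriv_ge0 (fun s => complex.Im (mu s i a b)) t (complex.Im (F a b))) /\
  mu 0 = qsimilarity D qbarycenter.

End Quantum.

Section Simplex.
Variables (R : realType) (c : nat).
Implicit Types (p q v lambda : 'rV[R]_c).

Definition simplex p : Prop := (forall j, 0 < p 0 j) /\ \sum_j p 0 j = 1.

Definition tangent0 : set 'rV[R]_c := [set v | \sum_j v 0 j = 0].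

Definition proj0 v : 'rV[R]_c := v - const_mx (c%:R^-1 * \sum_j v 0 j).

Definition replicator p : 'M[R]_c := diag_mx p - p^T *m p.

(* R_p v, for row vectors; replicator p is symmetric. *)
Definition replicate p v : 'rV[R]_c := v *m replicator p.

Definition tilt p v : 'rV[R]_c :=
  \row_j (p 0 j * expR (v 0 j) / \sum_k p 0 k * expR (v 0 k)).

Definition Exp p v : 'rV[R]_c := tilt p (\row_j (v 0 j / p 0 j)).

Definition Exp_inv p : 'rV[R]_c -> 'rV[R]_c := 'pinv_(fun=> 0) tangent0 (Exp p).

Definition likelihood p lambda : 'rV[R]_c := Exp p (replicate p (- proj0 lambda)).

End Simplex.

Section Classical.
Variables (R : realType) (V : finType) (G : weighted_graph R V) (c : nat).
Implicit Types (W lambda : V -> 'rV[R]_c).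

Definition manifold W : Prop := forall i, simplex (W i).

Definition barycenter : V -> 'rV[R]_c := fun=> const_mx c%:R^-1.

Definition Omega W (i : V) : 'rV[R]_c :=
  \sum_(k in nbhd G i) weight G i k *: W k.

Definition similarity lambda W (i : V) : 'rV[R]_c :=
  Exp (W i) (\sum_(k in nbhd G i)
    weight G i k *: Exp_inv (W i) (likelihood (W k) (lambda k))).

Definition af_solution lambda (S : R -> V -> 'rV[R]_c) : Prop :=
  (forall t : R, 0 <= t ->
     manifold (S t) /\
     forall i j,
       deriv_ge0 (fun s => S s i 0 j) t (replicate (S t i) (Omega (S t) i) 0 j)) /\
  S 0 = similarity lambda barycenter.

End Classical.

(* Main.v *)
Require Import Defs.
From mathcomp Require Import ring lra.

Import Order.TTheory GRing.Theory Num.Theory.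
Local Open Scope classical_set_scope.
Local Open Scope complex_scope.
Local Open Scope sesquilinear_scope.
Local Open Scope ring_scope.

Set Implicit Arguments.
Unset Strict Implicit.
Unset Printing Implicit Defensive.

(** The matrices [udiag U p], that is U Diag(p) U^*, form a commutative
algebra. When rho and X lie in it, the integrand rho^(1-l) X rho^l of
T_rho^-1[X] equals rho X for every l, so that R_rho acts on the diagonals as the
classical replicator matrix R_p ([qreplicator_udiag]). The averaging Omega, the
logarithm and the normalised exponential also act on the diagonals, and at the
barycenter both similarity maps reduce to the softmax of - Omega lambda
([similarity_barycenter], [qsimilarity_udiag]). Conjugating a classical
solution by U therefore gives a quantum one ([qsaf_udiag]).

A classical solution exists on the whole half-line because the substitution
S = softmax(H) turns the flow into H' = Omega softmax(H), whose right-hand side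
is bounded and globally Lipschitz ([softmax_lipschitz], [picard],
[af_exists]).

A quantum solution mu is not known beforehand to stay in the algebra, so
uniqueness needs a Lipschitz estimate of the quantum field at a diagonal
point, against arbitrary density matrices ([qreplicator_lipschitz]). For A
Hermitian with eigenvalues x_a and B = U Diag(s) U^*, the matrix f(A) - f(B),
written in an eigenbasis of A on the left and in U on the right, has entries
(f(x_a) - f(s_b)) q_ab with q independent of f. A scalar inequality
|f(x) - f(s)| <= L |x - s| thus passes to matrices ([udiag_lipschitz]). For
the powers y^l with 0 <= l <= 1 one has |x^l - s^l| <= |x - s| / s for all
x > 0 and 0 < s <= 1 ([powR_lipschitz]): no lower bound on the spectrum of A is
required, only one on the known classical solution, which a compact time
interval provides ([inv_bounded]). Gronwall's argument on the entries of the
difference concludes ([gronwall_eq0], [qsaf_unique]). *)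

(** * Derivatives on the half-line *)

Section DerivGe0.
Variable R : realType.
Implicit Types (f g : R -> R) (t l : R).

Lemma deriv_ge0P f t l : deriv_ge0 f t l <->
  forall e, 0 < e -> exists2 d, 0 < d & forall s, 0 <= s -> s != t ->
    `|s - t| < d -> `|l - (f s - f t) / (s - t)| <= e.
Proof.
split.
  move=> /cvgrPdist_le fl e e0; have /nbhs_ballP[d /= d0 H] := fl _ e0.
  exists d => // s s0 st sd; apply: H => //.
  by rewrite /ball /= distrC.
move=> H; apply/cvgrPdist_le => e e0; have [d d0 Hd] := H _ e0.
apply/nbhs_ballP; exists d => //= s; rewrite /ball /= distrC => sd st s0.
exact: Hd.
Qed.

Lemma is_derive_deriv_ge0 f t l : is_derive t 1 f l -> deriv_ge0 f t l.
Proof.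
move=> [df dl]; apply/deriv_ge0P => e e0.
have := df; rewrite /derivable -/('D_1 f t).
move=> /cvg_ex[l' fl'].
have l'E : l' = l by rewrite -dl; apply/esym/cvg_lim.
move: fl'; rewrite {}l'E => /cvgrPdist_le /(_ _ e0) /nbhs_ballP[d /= d0 H].
exists d => // s s0 st sd.
have := H (s - t); rewrite /ball /= sub0r normrN subr_eq0 => /(_ sd st).
by rewrite /= scaler1 subrK [_ *: _]mulrC.
Qed.

Lemma deriv_ge0_is_derive f t l : 0 < t -> deriv_ge0 f t l -> is_derive t 1 f l.
Proof.
move=> t0 /deriv_ge0P H.
suff fl : h^-1 *: (f (h *: (1:R) + t) - f t) @[h --> 0^'] --> l.
  by split; [apply/cvg_ex; exists l | apply/cvg_lim].
apply/cvgrPdist_le => e e0; have [d d0 Hd] := H _ e0.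
apply/nbhs_ballP; exists (Num.min d t); first by rewrite /= lt_min d0.
move=> h; rewrite /ball /= sub0r normrN lt_min => /andP[hd ht] h0.
have := Hd (h + t); rewrite addrK addrC -subr_eq0 addrAC subrr add0r.
rewrite scaler1 [h + t]addrC [_ *: _]mulrC; apply => //.
by have := ler_norm (- h); rewrite normrN; lra.
Qed.

Lemma deriv_ge0_continuous f t l : deriv_ge0 f t l ->
  f s @[s --> within [set s | 0 <= s] (nbhs t)] --> f t.
Proof.
move=> /deriv_ge0P /(_ 1 ltr01)[d d0 Hd]; apply/cvgrPdist_le => e e0.
pose M := `|l| + 1.
have M0 : 0 < M by rewrite ltr_wpDl.
apply/nbhs_ballP; exists (Num.min d (e / M)).
  by rewrite /= lt_min d0 divr_gt0.
move=> s; rewrite /ball /= distrC lt_min => /andP[sd se] s0.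
have [->|st] := eqVneq s t; first by rewrite subrr normr0 ltW.
have st0 : s - t != 0 by rewrite subr_eq0.
have := Hd _ s0 st sd; set q := _ / _ => qM.
have -> : f t - f s = - (q * (s - t)) by rewrite /q divfK// opprB.
rewrite normrN normrM.
have qM' : `|q| <= M.
  have -> : q = l - (l - q) by rewrite opprB addrC subrK.
  by rewrite (le_trans (ler_normB _ _))// lerD2l.
apply: (@le_trans _ _ (M * `|s - t|)); first by rewrite ler_wpM2r.
by rewrite mulrC -ler_pdivlMr// ltW.
Qed.

Lemma within_continuous_ge0 f df T :
  (forall t, 0 <= t -> deriv_ge0 f t (df t)) -> {within `[0, T], continuous f}.
Proof.
move=> H; apply/subspace_continuousP => t /=; rewrite in_itv/= => /andP[t0 _].
apply: cvg_trans (deriv_ge0_continuous (H t t0)); apply: cvg_app.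
by apply: within_subset => s /=; rewrite in_itv/= => /andP[].
Qed.

Lemma deriv_ge0_cst (a t : R) : deriv_ge0 (fun=> a) t 0.
Proof.
apply/deriv_ge0P => e e0; exists 1 => // s _ _ _.
by rewrite subrr mul0r subrr normr0 ltW.
Qed.

Lemma deriv_ge0D f g t l m : deriv_ge0 f t l -> deriv_ge0 g t m ->
  deriv_ge0 (fun s => f s + g s) t (l + m).
Proof.
rewrite /deriv_ge0 => fl gm; apply: cvg_trans (cvgD fl gm); apply: near_eq_cvg.
by near=> s; rewrite !fctE /=; ring.
Unshelve. all: by end_near. Qed.

Lemma deriv_ge0M f g t l m : 0 <= t -> deriv_ge0 f t l -> deriv_ge0 g t m ->
  deriv_ge0 (fun s => f s * g s) t (l * g t + f t * m).
Proof.
move=> t0 fl gm.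
have gt : g s @[s --> within [set s | 0 <= s] (t^')] --> g t.
  apply: cvg_trans (deriv_ge0_continuous gm); apply: cvg_app.
  by move=> A /nbhs_ballP[d d0 H]; apply/nbhs_ballP; exists d => // s sd st; exact: H.
have ft : f t @[s --> within [set s | 0 <= s] (t^')] --> f t by exact: cvg_cst.
apply: cvg_trans (cvgD (cvgM fl gt) (cvgM ft gm)); apply: near_eq_cvg.
by near=> s; rewrite !fctE /=; ring.
Unshelve. all: by end_near. Qed.

Lemma deriv_ge0Z f (a t l : R) : 0 <= t -> deriv_ge0 f t l ->
  deriv_ge0 (fun s => a * f s) t (a * l).
Proof.
by move=> t0 fl; have := deriv_ge0M t0 (deriv_ge0_cst a t) fl; rewrite mul0r add0r.
Qed.

Lemma deriv_ge0_sum (I : finType) (P : pred I) (f : I -> R -> R) (l : I -> R) t :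
  (forall i, P i -> deriv_ge0 (f i) t (l i)) ->
  deriv_ge0 (fun s => \sum_(i | P i) f i s) t (\sum_(i | P i) l i).
Proof.
move=> H; elim: (index_enum I) => [|i r IH].
  by under eq_fun do rewrite big_nil; rewrite big_nil; exact: deriv_ge0_cst.
under eq_fun do rewrite big_cons; rewrite big_cons.
by case: ifP => // Pi; apply: deriv_ge0D => //; exact: H.
Qed.

(** The mean value theorem: the derivative is two-sided on the open interval,
and [deriv_ge0] at the origin supplies the continuity there. *)
Lemma deriv_ge0_nincr f df T : 0 <= T ->
  (forall t, 0 <= t -> deriv_ge0 f t (df t)) ->
  (forall t, 0 < t -> t < T -> df t <= 0) -> f T <= f 0.
Proof.
move=> T0 fd df0.
have D t : t \in `]0, T[ -> is_derive t 1 f (df t).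
  rewrite in_itv/= => /andP[t0 tT].
  by apply: deriv_ge0_is_derive => //; apply: fd; exact: ltW.
apply: (@ler0_derive1_le_cc _ f 0 T) => //.
- by move=> t /D[].
- move=> t tT; rewrite derive1E; have [_ ->] := D _ tT.
  by move: tT; rewrite in_itv/= => /andP[? ?]; exact: df0.
- exact: within_continuous_ge0 fd.
- by rewrite in_itv/= T0 lexx.
- by rewrite in_itv/= lexx.
Qed.

Lemma deriv_ge0_le f df g dg T : 0 <= T ->
  (forall t, 0 <= t -> deriv_ge0 f t (df t)) ->
  (forall t, 0 <= t -> deriv_ge0 g t (dg t)) ->
  (forall t, 0 < t -> `|df t| <= dg t) -> `|f T - f 0| <= g T - g 0.
Proof.
move=> T0 fd gd H.
have key (a : R) : `|a| = 1 -> a * f T + -1 * g T <= a * f 0 + -1 * g 0.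
  move=> a1.
  apply: (@deriv_ge0_nincr (fun s => a * f s + -1 * g s)
     (fun s => a * df s + -1 * dg s)) => // t t0.
    by apply: deriv_ge0D; apply: deriv_ge0Z => //; [exact: fd|exact: gd].
  move=> _; have := H t t0; have := ler_norm (a * df t).
  by rewrite normrM a1; lra.
have := key 1 (normr1 _); have := key (-1); rewrite normrN1 => /(_ erefl).
by rewrite ler_norml => ? ?; apply/andP; split; lra.
Qed.

Lemma deriv_ge0_expR (a t : R) : deriv_ge0 (fun s => expR (a * s)) t (a * expR (a * t)).
Proof.
apply: is_derive_deriv_ge0; apply: is_derive_eq.
by rewrite /= [_ *: 1]mulr1 mulrC.
Qed.

(** Gronwall's inequality without square roots: the sum of squares E of the
components satisfies E' <= 2 |K| #|I| E, because 2 |y_j| |y_k| <= y_j^2 + y_k^2,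
so E times a decaying exponential is nonincreasing, nonnegative and starts
at 0. *)
Lemma gronwall_eq0 (I : finType) (y dy : I -> R -> R) (K T : R) : 0 <= T ->
  (forall i t, 0 <= t -> deriv_ge0 (y i) t (dy i t)) ->
  (forall i t, 0 < t -> t < T -> `|dy i t| <= K * \sum_j `|y j t|) ->
  (forall i, y i 0 = 0) -> forall i, y i T = 0.
Proof.
move=> T0 yd yK y0 i.
pose N : R := #|I|%:R.
pose L : R := - (2 * `|K| * N).
pose E t := \sum_j y j t * y j t.
pose dE t := \sum_j (dy j t * y j t + y j t * dy j t).
have Ed t : 0 <= t -> deriv_ge0 E t (dE t).
  by move=> t0; apply: deriv_ge0_sum => j _; apply: deriv_ge0M => //; exact: yd.
have dEE t : 0 < t -> t < T -> dE t <= - L * E t.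
  move=> t0 tT; rewrite /dE /L opprK.
  apply: (@le_trans _ _ (\sum_j \sum_k (`|K| * (y j t * y j t + y k t * y k t)))).
    apply: ler_sum => j _.
    apply: (@le_trans _ _ (2 * (`|y j t| * `|dy j t|))).
      rewrite -normrM; have := ler_norm (y j t * dy j t); lra.
    apply: (@le_trans _ _ (2 * (`|y j t| * (`|K| * \sum_k `|y k t|)))).
      rewrite ler_pM2l// ler_wpM2l//; apply: le_trans (yK j t t0 tT) _.
      by rewrite ler_wpM2r ?ler_norm// sumr_ge0.
    rewrite !mulr_sumr; apply: ler_sum => k _.
    have -> : y j t * y j t = `|y j t| * `|y j t|.
      by rewrite -expr2 -real_normK ?num_real// expr2.
    have -> : y k t * y k t = `|y k t| * `|y k t|.
      by rewrite -expr2 -real_normK ?num_real// expr2.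
    have := sqr_ge0 (`|y j t| - `|y k t|).
    have -> : 2 * (`|y j t| * (`|K| * `|y k t|)) = `|K| * (2 * (`|y j t| * `|y k t|)) by ring.
    by move=> ?; apply: ler_wpM2l => //; nra.
  rewrite le_eqVlt; apply/predU1P; left.
  under eq_bigr do rewrite -mulr_sumr big_split/= sumr_const -mulr_natr.
  rewrite -mulr_sumr big_split/= -mulr_suml sumr_const -mulr_natr.
  rewrite -/(E t) -mulr_natr -/N; ring.
have H : E T * expR (L * T) <= E 0 * expR (L * 0).
  apply: (@deriv_ge0_nincr (fun s => E s * expR (L * s))
    (fun s => dE s * expR (L * s) + E s * (L * expR (L * s)))) => // t t0.
    by apply: deriv_ge0M => //; [exact: Ed | exact: deriv_ge0_expR].
  move=> tT; have := dEE t t0 tT; have := expR_gt0 (L * t).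
  by rewrite mulrA -mulrDl => ? ?; rewrite pmulr_lle0//; lra.
have E0 : E 0 = 0 by apply: big1 => j _; rewrite y0 mul0r.
move: H; rewrite E0 mul0r pmulr_lle0 ?expR_gt0// => ET.
have /eqP : E T = 0.
  by apply/eqP; rewrite eq_le ET /=; apply: sumr_ge0 => j _; rewrite -expr2 sqr_ge0.
rewrite psumr_eq0; last by move=> j _; rewrite -expr2 sqr_ge0.
by move=> /allP/(_ i (mem_index_enum _)) /=; rewrite mulf_eq0 orbb => /eqP.
Qed.

End DerivGe0.

(** * Global existence for bounded Lipschitz fields *)

Section Picard.
Variable R : realType.
Notation leb := (@lebesgue_measure R).

Lemma lipschitz_continuous (f : R -> R) (B : R) :
  (forall s t, `|f s - f t| <= B * `|s - t|) -> continuous f.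
Proof.
move=> H t; apply/cvgrPdist_le => e e0.
have B0 : 0 < `|B| + 1 by rewrite ltr_wpDl.
apply/nbhs_ballP; exists (e / (`|B| + 1)); first exact: divr_gt0.
move=> s; rewrite /ball /= ltr_pdivlMr// => st.
apply: le_trans (H _ _) (le_trans _ (ltW st)).
rewrite mulrC ler_wpM2l//; have := ler_norm B; lra.
Qed.

(** The base point -1 makes every t >= 0 interior to the half-line on which
the fundamental theorem applies, so the derivative is two-sided at 0 too. *)
Definition prim (f : R -> R) (t : R) : R :=
  \int[leb]_(s in `[-1, t]) f s - \int[leb]_(s in `[-1, 0]) f s.

Lemma prim0 f : prim f 0 = 0. Proof. exact: subrr. Qed.

Lemma is_derive_prim (f : R -> R) (t : R) : continuous f -> 0 <= t ->
  is_derive t 1 (prim f) (f t).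
Proof.
move=> cf t0; have t1 : t < t + 1 by rewrite ltrDl.
have [|||df dE] := @continuous_FTC1_closed _ f (-1) t (t + 1) t1.
- apply: continuous_compact_integrable; first exact: segment_compact.
  exact: continuous_subspaceT.
- by rewrite (lt_le_trans _ t0)// ltrN10.
- exact: cf.
have D : is_derive t 1 (fun t => \int[leb]_(s in `[-1, t]) f s) (f t).
  by apply: DeriveDef; [exact: df|rewrite -derive1E; exact: dE].
by rewrite -[f t]subr0; apply: is_deriveB.
Qed.

Lemma prim_lipschitz (f : R -> R) (B s t : R) : continuous f ->
  (forall u, `|f u| <= B) -> 0 <= s -> 0 <= t ->
  `|prim f s - prim f t| <= B * `|s - t|.
Proof.
move=> cf fB; wlog st : s t / t <= s => [H|s0 t0].
  by case: (leP t s) => [/H//|/ltW/H h] ? ?; rewrite distrC [`|s - t|]distrC; exact: h.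
have [||c _ ->] := @MVT_segment _ (prim f) f t s st.
- move=> x; rewrite in_itv/= => /andP[tx _]; apply: is_derive_prim => //.
  by rewrite (le_trans t0)// ltW.
- apply/subspace_continuousP => x; rewrite /= in_itv/= => /andP[tx _].
  apply: cvg_within_filter.
  apply: differentiable_continuous; apply/derivable1_diffP.
  by have [] := is_derive_prim cf (le_trans t0 tx).
by rewrite normrM ler_wpM2r.
Qed.

Lemma le_geometric (a b c : R) : (forall n : nat, a <= b + c / 2 ^+ n) -> a <= b.
Proof.
move=> H; rewrite leNgt; apply/negP => ba.
have c0 : 0 < c by have := H 0%N; rewrite expr0 divr1; lra.
pose n := Num.truncn (c / (a - b)).
have := H n; apply/negP; rewrite -ltNge -ltrBrDl ltr_pdivrMr ?exprn_gt0//.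
rewrite mulrC -ltr_pdivrMr ?subr_gt0//.
apply: lt_le_trans (Num.Theory.truncnS_gt _) _; rewrite -natrX ler_nat; exact: ltn_expl.
Qed.

(** The intervals of radius 2 A / 2^n around a_n are nested: their left ends
increase, their right ends decrease, and the supremum of the left ends lies in
all of them. *)
Lemma geometric_limit (a : nat -> R) (A : R) :
  (forall n, `|a n.+1 - a n| <= A / 2 ^+ n) ->
  {l : R | forall n, `|l - a n| <= 2 * A / 2 ^+ n}.
Proof.
move=> aA.
pose b n := a n - 2 * A / 2 ^+ n; pose d n := a n + 2 * A / 2 ^+ n.
have A0 n : 0 <= A / 2 ^+ n by apply: le_trans (aA n).
have hS n : 2 * A / 2 ^+ n.+1 = A / 2 ^+ n.
  by rewrite exprS; field; rewrite expf_neq0.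
have bS n : b n <= b n.+1.
  by rewrite /b hS; have := aA n; rewrite ler_norml => /andP[]; lra.
have dS n : d n.+1 <= d n.
  by rewrite /d hS; have := aA n; rewrite ler_norml => /andP[]; lra.
have bd m n : b m <= d n.
  apply: (@le_trans _ _ (b (maxn m n))).
    exact: (homo_leq (@lexx _ _) (@le_trans _ _) bS) (leq_maxl m n).
  apply: (@le_trans _ _ (d (maxn m n))).
    by rewrite /b /d; have := A0 (maxn m n); lra.
  exact: (homo_leq (@lexx _ _) (fun x y z yx zy => le_trans zy yx) dS) (leq_maxr m n).
pose E := range b.
exists (sup E) => n.
have E1 : E !=set0 by exists (b 0%N); exists 0%N.
have E2 : ubound E (d n) by move=> _ [m _ <-].
rewrite ler_norml; apply/andP; split.
  have : b n <= sup E by apply: ub_le_sup; [exists (d n)|exists n].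
  by rewrite /b; lra.
have : sup E <= d n by apply: ge_sup.
by rewrite /d; lra.
Qed.

Section PicardIteration.
Variables (I : finType) (F : (I -> R) -> I -> R) (K B : R) (x0 : I -> R).
Hypothesis F_lip : forall x y e, `|F x e - F y e| <= K * \sum_f `|x f - y f|.
Hypothesis F_bnd : forall x e, `|F x e| <= B.
Hypothesis K0 : 0 <= K.

Implicit Types (x y : R -> I -> R) (s t : R) (e f : I).

(** Iterates are frozen on the negative half-line by [ext]: they are then
Lipschitz on the whole line, as [is_derive_prim] needs continuity there. *)
Let lip (x : R -> I -> R) := forall s t e, `|x s e - x t e| <= B * `|s - t|.
Let step (x : R -> I -> R) t e := x0 e + prim (fun s => F (x s) e) t.
Let ext (x : R -> I -> R) (t : R) := x (Num.max t 0).
Let N : R := #|I|%:R.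
(** Weight of the norm sup |x t| exp(- M t), in which [step] contracts by 1/2. *)
Let M : R := 2 * (K * N + 1).
Let C : R := B / M.

Let KN0 : 0 <= K * N. Proof. by rewrite mulr_ge0 ?ler0n. Qed.
Let M0 : 0 < M. Proof. by have := KN0; rewrite /M; lra. Qed.

Let F_cont x e : lip x -> continuous (fun s => F (x s) e).
Proof.
move=> xl; apply: (@lipschitz_continuous _ (K * (N * B))) => s t.
apply: le_trans (F_lip _ _ _) _; rewrite -!mulrA ler_wpM2l//.
rewrite -[leRHS]mulrC mulr_natr -sumr_const; apply: ler_sum => f _; exact: xl.
Qed.

Let max_lip (s t : R) : `|Num.max s (0 : R) - Num.max t 0| <= `|s - t|.
Proof.
have := ler_norm (s - t); have := ler_norm (t - s); rewrite [`|t - s|]distrC => ? ?.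
have := normr_ge0 (s - t).
rewrite ler_norml /Num.max; case: ifP => ?; case: ifP => ? ?;
  by apply/andP; split; lra.
Qed.

Let step_lip x : lip x -> lip (ext (step x)).
Proof.
move=> xl s t e; rewrite /ext /step [_ + prim _ _]addrC addrKA.
have B0 : 0 <= B by apply: le_trans (F_bnd x0 e).
apply: le_trans (prim_lipschitz (@F_cont x e xl) _ _ _) _.
- by move=> u; exact: F_bnd.
- by rewrite le_max lexx orbT.
- by rewrite le_max lexx orbT.
by rewrite ler_wpM2l.
Qed.

Let step_derive x t e : lip x -> 0 <= t ->
  is_derive t 1 (fun s => step x s e) (F (x t) e).
Proof.
move=> xl t0; rewrite -[F _ _]add0r; apply: is_deriveD.
exact: is_derive_prim (@F_cont x e xl) t0.
Qed.

Let step_dist x y (a : R) e t : lip x -> lip y -> 0 <= t ->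
  (forall s, 0 <= s -> `|F (x s) e - F (y s) e| <= M * a * expR (M * s)) ->
  `|step x t e - step y t e| <= a * expR (M * t).
Proof.
move=> xl yl t0 H.
have a0 : 0 <= a.
  have := le_trans (normr_ge0 _) (H 0 (lexx _)).
  by rewrite pmulr_lge0 ?expR_gt0// pmulr_rge0.
pose g s := step x s e + -1 * step y s e.
have -> : step x t e - step y t e = g t - g 0.
  by rewrite /g /step !prim0; ring.
apply: (@le_trans _ _ (a * expR (M * t) - a * expR (M * 0))); last first.
  by rewrite gerBl mulr_ge0 ?expR_ge0.
apply: (@deriv_ge0_le _ g (fun s => F (x s) e + -1 * F (y s) e)
  (fun s => a * expR (M * s)) (fun s => a * (M * expR (M * s)))) => //.
- move=> s s0; apply: deriv_ge0D; last apply: deriv_ge0Z => //.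
  + by apply: is_derive_deriv_ge0; exact: (@step_derive x s e xl).
  + by apply: is_derive_deriv_ge0; exact: (@step_derive y s e yl).
- by move=> s s0; apply: deriv_ge0Z => //; exact: deriv_ge0_expR.
- move=> s s0; rewrite mulN1r (le_trans (H s (ltW s0)))//.
  by rewrite mulrCA mulrA.
Qed.

Let xs (n : nat) : R -> I -> R := iter n (fun x => ext (step x)) (fun=> x0).

Let xs_lip n : lip (xs n).
Proof.
elim: n => [s t e|n IH]; last exact: step_lip.
by rewrite subrr normr0 mulr_ge0//; apply: le_trans (F_bnd x0 e).
Qed.

Let xsS n t : 0 <= t -> xs n.+1 t = step (xs n) t.
Proof. by move=> t0; rewrite /= /ext max_l. Qed.

Let F_dist (x y : I -> R) (a t : R) e : (forall f, `|x f - y f| <= a * expR (M * t)) ->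
  `|F x e - F y e| <= M * (a / 2) * expR (M * t).
Proof.
move=> H.
have a0 : 0 <= a.
  by have := le_trans (normr_ge0 _) (H e); rewrite pmulr_lge0 ?expR_gt0.
apply: le_trans (F_lip _ _ _) _.
apply: (@le_trans _ _ (K * (N * (a * expR (M * t))))).
  rewrite ler_wpM2l// mulrC mulr_natr -sumr_const.
  by apply: ler_sum => f _; exact: H.
rewrite !mulrA ler_wpM2r ?expR_ge0//.
have -> : M * a / 2 = (K * N + 1) * a by rewrite /M; field.
by rewrite ler_wpM2r// lerDl.
Qed.

Let xs_dist n t e : 0 <= t -> `|xs n.+1 t e - xs n t e| <= C / 2 ^+ n * expR (M * t).
Proof.
elim: n t e => [|n IH] t e t0.
  have B0 : 0 <= B by apply: le_trans (F_bnd x0 e).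
  rewrite expr0 divr1 xsS//.
  have -> : xs 0 t e = step (xs 0) 0 e by rewrite /step prim0 addr0.
  apply: (@le_trans _ _ (C * expR (M * t) - C * expR (M * 0))); last first.
    by rewrite gerBl mulr_ge0 ?expR_ge0// divr_ge0// ltW.
  apply: (@deriv_ge0_le _ (fun s => step (xs 0) s e)
    (fun s => F (xs 0 s) e) (fun s => C * expR (M * s))
    (fun s => C * (M * expR (M * s)))) => //.
  - by move=> s s0; apply: is_derive_deriv_ge0; apply: step_derive => //; exact: (xs_lip 0).
  - by move=> s s0; apply: deriv_ge0Z => //; exact: deriv_ge0_expR.
  - move=> s s0; apply: le_trans (F_bnd _ _) _.
    rewrite mulrA divfK ?gt_eqF// ler_peMr// -expR0 ler_expR.
    by rewrite mulr_ge0// ltW.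
rewrite (xsS n)// (xsS n.+1)//; apply: step_dist => // s s0.
have -> : C / 2 ^+ n.+1 = C / 2 ^+ n / 2 by rewrite exprSr invfM mulrA.
apply: F_dist => f; exact: IH.
Qed.

(** The iterates converge geometrically in the weighted norm. Passing to the
limit needs no theorem on differentiating limits: x is Lipschitz as a pointwise
limit of uniformly Lipschitz functions, hence [step x] is defined, and its
distance to the iterates also tends to 0, so that [step x] = x on the
half-line. *)
Lemma picard : exists x : R -> I -> R, x 0 = x0 /\
  forall t e, 0 <= t -> is_derive t 1 (fun s => x s e) (F (x t) e).
Proof.
have lim t e : {l : R | forall n, `|l - xs n (Num.max t 0) e|
    <= 2 * (C * expR (M * Num.max t 0)) / 2 ^+ n}.
  apply: geometric_limit => n.
  apply: le_trans (xs_dist _ _ _) _; first by rewrite le_max lexx orbT.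
  by rewrite mulrAC.
pose x t e := sval (lim t e).
have xE t e n : 0 <= t -> `|x t e - xs n t e| <= 2 * C / 2 ^+ n * expR (M * t).
  move=> t0; rewrite /x; case: (lim t e) => l /= /(_ n).
  by rewrite max_l// mulrA [_ * expR _ / _]mulrAC.
have xlip : lip x.
  move=> s t e; pose s' := Num.max s 0; pose t' := Num.max t 0.
  have B0 : 0 <= B by apply: le_trans (F_bnd x0 e).
  pose Q u := 2 * (C * expR (M * u)).
  apply: (@le_geometric _ _ (Q s' + Q t')) => n.
  have := svalP (lim s e) n; have := svalP (lim t e) n.
  rewrite -/(x t e) -/(x s e) -/s' -/t' -/(Q s') -/(Q t') => h1 h2.
  have h3 : `|xs n s' e - xs n t' e| <= B * `|s - t|.
    apply: le_trans (xs_lip n s' t' e) _; apply: ler_wpM2l => //; exact: max_lip.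
  have -> : x s e - x t e = (x s e - xs n s' e) + (xs n s' e - xs n t' e)
    - (x t e - xs n t' e) by ring.
  have := ler_normB (x s e - xs n s' e + (xs n s' e - xs n t' e)) (x t e - xs n t' e).
  have := ler_normD (x s e - xs n s' e) (xs n s' e - xs n t' e).
  by rewrite mulrDl; lra.
have yx t : 0 <= t -> step x t = x t.
  move=> t0; apply/funext => e; apply/eqP; rewrite -subr_eq0 -normr_le0.
  apply: (@le_geometric _ _ (2 * C * expR (M * t))) => n; rewrite add0r.
  have -> : step x t e - x t e =
     (step x t e - xs n.+1 t e) - (x t e - xs n.+1 t e) by ring.
  apply: le_trans (ler_normB _ _) _.
  have -> : 2 * C * expR (M * t) / 2 ^+ n =
    (2 * C / 2 ^+ n) / 2 * expR (M * t) + 2 * C / 2 ^+ n.+1 * expR (M * t).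
    by rewrite exprS; field; rewrite expf_neq0.
  apply: lerD; last exact: xE.
  rewrite (xsS n)//; apply: step_dist => // s s0; apply: F_dist => f; exact: xE.
exists (step x); split; first by apply/funext => e; rewrite /step prim0 addr0.
by move=> t e t0; rewrite yx//; exact: step_derive.
Qed.

End PicardIteration.
End Picard.

(** * Softmax and the simplex *)

Section Softmax.
Variables (R : realType) (c : nat).
Implicit Types (p v w : 'rV[R]_c).

Definition softmax v : 'rV[R]_c :=
  \row_j (expR (v 0 j) / \sum_k expR (v 0 k)).

Lemma softmax_den_gt0 v : (0 < c)%N -> 0 < \sum_k expR (v 0 k).
Proof.
case: c v => // n v _; rewrite big_ord_recl ltr_pwDl ?expR_gt0//.
by apply: sumr_ge0 => k _; exact: expR_ge0.
Qed.

Lemma simplex_softmax v : (0 < c)%N -> simplex (softmax v).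
Proof.
move=> c0; have Z0 := softmax_den_gt0 v c0; split=> [j|].
  by rewrite mxE divr_gt0 ?expR_gt0.
under eq_bigr do rewrite mxE.
by rewrite -mulr_suml divff// gt_eqF.
Qed.

Lemma simplex_le1 p j : simplex p -> p 0 j <= 1.
Proof.
move=> [p0 p1]; rewrite -p1 (bigD1 j)//= lerDl sumr_ge0// => k _; exact: ltW.
Qed.

Lemma tilt_shift p v (a : R) : tilt p (v + const_mx a) = tilt p v.
Proof.
apply/rowP => j; rewrite !mxE.
have E k : p 0 k * expR ((v + const_mx a) 0 k) = p 0 k * expR (v 0 k) * expR a.
  by rewrite !mxE expRD mulrA.
under [X in _ / X]eq_bigr do rewrite E.
by rewrite expRD mulrA -mulr_suml -mulf_div divff ?mulr1// gt_eqF ?expR_gt0.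
Qed.

Lemma tilt_const (a : R) v : a != 0 -> tilt (const_mx a) v = softmax v.
Proof.
move=> a0; apply/rowP => j; rewrite !mxE.
under [X in _ / X]eq_bigr do rewrite mxE.
by rewrite -mulr_sumr -mulf_div divff ?mul1r.
Qed.

Lemma replicateE p v j : replicate p v 0 j = p 0 j * (v 0 j - \sum_k p 0 k * v 0 k).
Proof.
rewrite /replicate /replicator mulmxBr mul_mx_diag mulmxA !mxE big_ord1.
rewrite mulrBr mulrC; congr (_ - _); rewrite mulrC; congr (_ * _).
by rewrite mxE; apply: eq_bigr => k _; rewrite mxE mulrC.
Qed.

Lemma replicate_tangent p v : simplex p -> tangent0 (replicate p v).
Proof.
move=> [p0 p1]; rewrite /tangent0 /=.
under eq_bigr do rewrite replicateE mulrBr.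
by rewrite sumrB -mulr_suml p1 mul1r subrr.
Qed.

Lemma replicate_shift p v (a : R) : simplex p ->
  replicate p (v + const_mx a) = replicate p v.
Proof.
move=> [p0 p1]; apply/rowP => j; rewrite !replicateE; congr (_ * _).
under eq_bigr do rewrite !mxE mulrDr.
rewrite big_split/= -mulr_suml p1 mul1r !mxE; ring.
Qed.

(** Equality of the images forces v / p and w / p to differ by a constant a,
that is v - w = a p; summing gives a = 0 since v and w are tangent. *)
Lemma Exp_inj p v w : simplex p -> tangent0 v -> tangent0 w ->
  Exp p v = Exp p w -> v = w.
Proof.
move=> [p0 p1] v0 w0 /rowP E.
set Zv := \sum_k p 0 k * expR (v 0 k / p 0 k).
set Zw := \sum_k p 0 k * expR (w 0 k / p 0 k).
have c0 : exists j : 'I_c, true.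
  case: (pickP 'I_c) => [j _|h]; first by exists j.
  by move/eqP: p1; rewrite big_pred0// eq_sym oner_eq0.
have Z0 u : 0 < \sum_k p 0 k * expR (u 0 k / p 0 k).
  have [j _] := c0; rewrite (bigD1 j)//= ltr_pwDl ?mulr_gt0 ?expR_gt0//.
  by apply: sumr_ge0 => k _; rewrite mulr_ge0 ?expR_ge0// ltW.
have Zv0 : 0 < Zv by exact: Z0.
have Zw0 : 0 < Zw by exact: Z0.
have H j : v 0 j - w 0 j = ln (Zv / Zw) * p 0 j.
  have := E j; rewrite !mxE.
  have -> : \sum_k p 0 k * expR ((\row_j (v 0 j / p 0 j)) 0 k) = Zv.
    by apply: eq_bigr => k _; rewrite mxE.
  have -> : \sum_k p 0 k * expR ((\row_j (w 0 j / p 0 j)) 0 k) = Zw.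
    by apply: eq_bigr => k _; rewrite mxE.
  rewrite -!mulrA => /(mulfI (lt0r_neq0 (p0 j))) e.
  have {}e : expR ((v 0 j - w 0 j) / p 0 j) = Zv / Zw.
    rewrite mulrBl expRB; apply: (mulIf (lt0r_neq0 Zw0)).
    rewrite divfK ?gt_eqF//.
    move/(congr1 (fun z => z * Zv)): e; rewrite divfK ?gt_eqF// => ->.
    by field; rewrite !gt_eqF ?expR_gt0.
  by rewrite -e expRK divfK// gt_eqF.
have L0 : ln (Zv / Zw) = 0.
  have : \sum_j (v 0 j - w 0 j) = 0 by rewrite sumrB v0 w0 subrr.
  by under eq_bigr do rewrite H; rewrite -mulr_sumr p1 mulr1.
by apply/rowP => j; apply/eqP; rewrite -subr_eq0 H L0 mul0r.
Qed.

Lemma Exp_invK p v : simplex p -> tangent0 v -> Exp_inv p (Exp p v) = v.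
Proof.
move=> sp v0; rewrite /Exp_inv pinvKV// ?inE// => x y.
by rewrite !inE => x0 y0; exact: Exp_inj.
Qed.

(** Moving the argument by at most d multiplies numerator and denominator by
factors in [exp(-d), exp(d)], hence softmax w >= exp(-2d) softmax v, and
1 - exp(-2d) <= 2d. *)
Lemma softmax_le v w (d : R) j : (0 < c)%N ->
  (forall k, `|v 0 k - w 0 k| <= d) -> softmax v 0 j - softmax w 0 j <= 2 * d.
Proof.
move=> c0 H.
have d0 : 0 <= d by apply: le_trans (H j).
have Zv0 := softmax_den_gt0 v c0; have Zw0 := softmax_den_gt0 w c0.
have e1 : expR (- d) * expR (v 0 j) <= expR (w 0 j).
  by rewrite -expRD ler_expR; have := ler_norm (v 0 j - w 0 j); have := H j; lra.
have e2 : \sum_k expR (w 0 k) <= expR d * \sum_k expR (v 0 k).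
  rewrite mulr_sumr; apply: ler_sum => k _; rewrite -expRD ler_expR.
  by have := ler_norm (w 0 k - v 0 k); have := H k; rewrite distrC; lra.
have s1 := simplex_le1 j (simplex_softmax v c0).
have s0 : 0 < softmax v 0 j by have [] := simplex_softmax v c0.
have e3 : expR (- (2 * d)) * softmax v 0 j <= softmax w 0 j.
  rewrite !mxE ler_pdivlMr//.
  apply: le_trans e1.
  have -> : expR (- (2 * d)) = expR (- d) / expR d by rewrite -expRB; congr expR; ring.
  apply: (@le_trans _ _ (expR (- d) / expR d *
    (expR (v 0 j) / (\sum_k expR (v 0 k))) *
    (expR d * \sum_k expR (v 0 k)))).
    by rewrite ler_pM2l// !(mulr_gt0, invr_gt0, expR_gt0).
  by rewrite le_eqVlt; apply/predU1P; left; field; rewrite !gt_eqF ?expR_gt0.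
have e4 := expR_ge1Dx (- (2 * d)).
have : (1 - expR (- (2 * d))) * softmax v 0 j <= (2 * d) * 1.
  apply: ler_pM => //; [|exact: ltW|lra].
  by rewrite subr_ge0 expR_le1; lra.
lra.
Qed.

Lemma softmax_lipschitz v w (d : R) j : (0 < c)%N ->
  (forall k, `|v 0 k - w 0 k| <= d) -> `|softmax v 0 j - softmax w 0 j| <= 2 * d.
Proof.
move=> c0 H; rewrite ler_norml lerNl opprB !softmax_le// => k.
by rewrite distrC.
Qed.

Lemma is_derive_softmax (y : R -> 'I_c -> R) (w : 'rV[R]_c) (t : R) j : (0 < c)%N ->
  (forall k, is_derive t 1 (fun s => y s k) (w 0 k)) ->
  is_derive t 1 (fun s => softmax (\row_k y s k) 0 j)
    (replicate (softmax (\row_k y t k)) w 0 j).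
Proof.
move=> c0 yd.
pose Z s := \sum_k expR (y s k).
have Z0 s : Z s != 0.
  have := softmax_den_gt0 (\row_k y s k) c0.
  by under eq_bigr do rewrite mxE; move/lt0r_neq0.
have ed k : is_derive t 1 (fun s => expR (y s k)) (expR (y t k) * w 0 k).
  by apply: (is_derive1_comp (f := @expR R)).
have Zd : is_derive t 1 Z (\sum_k (expR (y t k) * w 0 k)).
  have -> : Z = \sum_k (fun s => expR (y s k)).
    by apply/funext => s; rewrite fct_sumE.
  exact: is_derive_sum.
have sE s k : softmax (\row_k y s k) 0 k = expR (y s k) * (Z s)^-1.
  rewrite !mxE; congr (_ / _); apply: eq_bigr => l _; by rewrite mxE.
have -> : (fun s => softmax (\row_k y s k) 0 j) =
    (fun s => expR (y s j)) * (fun s => (Z s)^-1).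
  by apply/funext => s; rewrite sE.
have Vd := is_deriveV (Z0 t) Zd.
apply: is_derive_eq; rewrite replicateE !sE.
have -> : \sum_k softmax (\row_k y t k) 0 k * w 0 k = (Z t)^-1 * \sum_k expR (y t k) * w 0 k.
  by rewrite mulr_sumr; apply: eq_bigr => k _; rewrite sE; ring.
set W := \sum_k _.
rewrite /GRing.scale /=. field. exact: Z0.
Qed.

End Softmax.

(** * Existence of the classical assignment flow *)

Section ClassicalFlow.
Variables (R : realType) (V : finType) (G : weighted_graph R V) (c : nat).
Hypothesis c_gt0 : (0 < c)%N.
Implicit Types (W lambda : V -> 'rV[R]_c).

Lemma weight_nbhd_sum i : \sum_(k in nbhd G i) weight G i k = 1.
Proof. by rewrite -(weight_sum G i); apply: eq_bigl => k; rewrite inE. Qed.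

Lemma simplex_barycenter i : simplex (@barycenter R V c i).
Proof.
split=> [j|]; first by rewrite mxE invr_gt0 ltr0n.
under eq_bigr do rewrite mxE.
by rewrite sumr_const card_ord -(mulr_natr c%:R^-1) mulVf// pnatr_eq0 -lt0n.
Qed.

(** The likelihoods are images under [Exp] of tangent vectors, so [Exp_inv]
recovers those; at the barycenter their division by p removes the factor p of
the replicator, and all the centering terms are constant shifts. *)
Lemma similarity_barycenter lambda i :
  similarity G lambda (@barycenter R V c) i =
  softmax (- \sum_(k in nbhd G i) weight G i k *: lambda k).
Proof.
have sb := simplex_barycenter; rewrite /similarity.
have cn0 : c%:R^-1 != 0 :> R by rewrite invr_eq0 pnatr_eq0 -lt0n.
set b := @barycenter R V c.
have LE k : Exp_inv (b i) (likelihood (b k) (lambda k)) = replicate (b i) (- lambda k).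
  rewrite /likelihood Exp_invK//; last exact: replicate_tangent.
  rewrite /proj0 opprB addrC -[const_mx _]opprK opprK.
  exact: replicate_shift.
under eq_bigr do rewrite LE.
rewrite /Exp /b /barycenter tilt_const//.
set s := \row_j _.
pose a : R := \sum_(k in nbhd G i) weight G i k * \sum_l c%:R^-1 * lambda k 0 l.
have -> : s = - (\sum_(k in nbhd G i) weight G i k *: lambda k) + const_mx a.
  apply/rowP => j; rewrite [LHS]mxE summxE [X in _ / X]mxE mulr_suml.
  rewrite [RHS]mxE [X in X + _]mxE [X in _ + X]mxE summxE -sumrN -big_split/=.
  apply: eq_bigr => k _; rewrite [in LHS]mxE replicateE.
  under [X in _ * (_ * (_ - X)) / _]eq_bigr do rewrite !mxE mulrN.
  rewrite sumrN opprK !mxE -mulr_sumr; field.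
  by rewrite pnatr_eq0 -lt0n.
by rewrite -(tilt_const _ cn0) tilt_shift tilt_const.
Qed.

(** The simplex constraint and the quadratic growth disappear in the
logarithmic coordinates H, where the field Omega softmax(H) is bounded by 1
and globally Lipschitz. *)
Lemma af_exists lambda : exists S : R -> V -> 'rV[R]_c, af_solution G lambda S.
Proof.
pose I := (V * 'I_c)%type.
pose sm (x : I -> R) k : 'rV[R]_c := softmax (\row_j x (k, j)).
pose F (x : I -> R) (e : I) : R := \sum_(k in nbhd G e.1) weight G e.1 k * sm x k 0 e.2.
pose h0 (e : I) : R := (- \sum_(k in nbhd G e.1) weight G e.1 k *: lambda k) 0 e.2.
have [|||h [hi hd]] := @picard R I F 2 1 h0.
- move=> x y e; rewrite /F -sumrB.
  under eq_bigr do rewrite -mulrBr.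
  apply: le_trans (ler_norm_sum _ _ _) _.
  apply: (@le_trans _ _ ((\sum_(k in nbhd G e.1) weight G e.1 k) *
    (2 * \sum_f `|x f - y f|))); last by rewrite weight_nbhd_sum mul1r.
  rewrite mulr_suml; apply: ler_sum => k _.
  rewrite normrM ger0_norm ?weight_ge0// ler_wpM2l ?weight_ge0//.
  apply: softmax_lipschitz => // j; rewrite !mxE (bigD1 (k, j))//= lerDl.
  exact: sumr_ge0.
- move=> x e; apply: le_trans (ler_norm_sum _ _ _) _.
  rewrite -[leRHS](weight_nbhd_sum e.1).
  apply: ler_sum => k _; have s := simplex_softmax (\row_j x (k, j)) c_gt0.
  rewrite ger0_norm; last by rewrite mulr_ge0 ?weight_ge0// ltW//; case: s.
  by rewrite ler_piMr ?weight_ge0// simplex_le1.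
- by [].
exists (fun t i => sm (h t) i); split; last first.
  apply/funext => i; rewrite similarity_barycenter /sm hi; congr softmax.
  by apply/rowP => j; rewrite mxE.
move=> t t0; split=> [i|i j]; first exact: simplex_softmax.
apply: is_derive_deriv_ge0; apply: is_derive_softmax => // k.
have -> : Omega G (sm (h t)) i 0 k = F (h t) (i, k).
  by rewrite /Omega summxE; apply: eq_bigr => l _; rewrite mxE.
exact: hd.
Qed.

End ClassicalFlow.

(** * Matrices diagonal in a fixed unitary basis *)

Section UnitaryDiagonal.
Variables (R : realType) (c : nat) (U : 'M[R[i]]_c).
Hypothesis U_unitary : U \is unitarymx.
Implicit Types (p q y : 'rV[R]_c).

Definition udiag p : 'M[R[i]]_c := U *m cdiag p *m U ^t*.

Lemma unitary_adj_mul : U ^t* *m U = 1%:M.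
Proof. by rewrite -invmx_unitary // mulVmx ?unitarymx_unit. Qed.

Lemma unitary_mul_adj : U *m U ^t* = 1%:M.
Proof. by rewrite -invmx_unitary // mulmxV ?unitarymx_unit. Qed.

Lemma Re_sum (I : Type) (r : seq I) (P : pred I) (f : I -> R[i]) :
  complex.Re (\sum_(i <- r | P i) f i) = \sum_(i <- r | P i) complex.Re (f i).
Proof. by apply: big_morph => // -[? ?] [? ?]. Qed.

Lemma Im_sum (I : Type) (r : seq I) (P : pred I) (f : I -> R[i]) :
  complex.Im (\sum_(i <- r | P i) f i) = \sum_(i <- r | P i) complex.Im (f i).
Proof. by apply: big_morph => // -[? ?] [? ?]. Qed.

Lemma Re_realM (x : R) (z : R[i]) : complex.Re (x%:C * z) = x * complex.Re z.
Proof. by case: z => a b /=; rewrite mul0r subr0. Qed.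

Lemma Im_realM (x : R) (z : R[i]) : complex.Im (x%:C * z) = x * complex.Im z.
Proof. by case: z => a b /=; rewrite mul0r addr0. Qed.

Lemma udiagE p a b : udiag p a b = \sum_j (p 0 j)%:C * (U a j * (U ^t*) j b).
Proof.
rewrite /udiag mul_mx_diag !mxE; apply: eq_bigr => j _; rewrite !mxE; ring.
Qed.

Lemma Re_udiag p a b :
  complex.Re (udiag p a b) = \sum_j complex.Re (U a j * (U ^t*) j b) * p 0 j.
Proof.
by rewrite udiagE Re_sum; apply: eq_bigr => j _; rewrite Re_realM mulrC.
Qed.

Lemma Im_udiag p a b :
  complex.Im (udiag p a b) = \sum_j complex.Im (U a j * (U ^t*) j b) * p 0 j.
Proof.
by rewrite udiagE Im_sum; apply: eq_bigr => j _; rewrite Im_realM mulrC.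
Qed.

Lemma udiag_const (a : R) : udiag (const_mx a) = (a%:C)%:M.
Proof.
rewrite /udiag; have -> : @cdiag R c (const_mx a) = (a%:C)%:M.
  by apply/matrixP => i j; rewrite !mxE.
by rewrite mul_mx_scalar -scalemxAl unitary_mul_adj scalemx1.
Qed.

Lemma udiagM p q : udiag p *m udiag q = udiag (\row_j (p 0 j * q 0 j)).
Proof.
have -> : udiag p *m udiag q = U *m (cdiag p *m ((U ^t* *m U) *m cdiag q)) *m U ^t*.
  by rewrite /udiag !mulmxA.
rewrite unitary_adj_mul mul1mx /udiag; congr (_ *m _ *m _).
rewrite mulmx_diag; congr diag_mx; apply/rowP => j; rewrite !mxE.
by rewrite rmorphM.
Qed.

Lemma udiagX p n : udiag p ^+ n = udiag (\row_j (p 0 j ^+ n)).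
Proof.
elim: n => [|n IH].
  have -> : \row_j p 0 j ^+ 0 = const_mx 1 by apply/rowP => j; rewrite !mxE.
  by rewrite udiag_const.
rewrite exprS IH [_ * _]udiagM; congr udiag; apply/rowP => j.
by rewrite !mxE exprS.
Qed.

Lemma udiagD p q : udiag (p + q) = udiag p + udiag q.
Proof.
apply/matrixP => a b; rewrite [RHS]mxE !udiagE -big_split/=.
by apply: eq_bigr => j _; rewrite mxE rmorphD mulrDl.
Qed.

Lemma udiagZ (x : R) p : udiag (x *: p) = x%:C *: udiag p.
Proof.
apply/matrixP => a b; rewrite [RHS]mxE !udiagE mulr_sumr.
by apply: eq_bigr => j _; rewrite mxE rmorphM -mulrA.
Qed.

Lemma udiag0 : udiag 0 = 0.
Proof. by have := udiagZ 0 0; rewrite scale0r rmorph0 scale0r. Qed.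

Lemma udiag_sum (I : Type) (r : seq I) (P : pred I) (f : I -> 'rV[R]_c) :
  udiag (\sum_(i <- r | P i) f i) = \sum_(i <- r | P i) udiag (f i).
Proof. apply: big_morph => [p q|]; [exact: udiagD | exact: udiag0]. Qed.

Lemma udiagN p : udiag (- p) = - udiag p.
Proof. by rewrite -scaleN1r udiagZ rmorphN1 scaleN1r. Qed.

Lemma tr_udiag p : \tr (udiag p) = (\sum_j p 0 j)%:C.
Proof.
rewrite /udiag mxtrace_mulC mulmxA unitary_adj_mul mul1mx mxtrace_diag rmorph_sum.
by apply: eq_bigr => j _; rewrite mxE.
Qed.

Lemma posdef_udiag p : (forall j, 0 < p 0 j) -> posdefmx (udiag p).
Proof.
move=> p0; split.
  apply/is_hermitianmxP; rewrite expr0 scale1r /udiag.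
  rewrite !(trmx_mul, map_mxM) trmxCK mulmxA; congr (_ *m _ *m _).
  apply/matrixP => a b; rewrite !mxE eq_sym; have [->|_] := eqVneq a b.
    rewrite !mulr1n; exact/esym/conjc_real.
  by rewrite !mulr0n rmorph0.
move=> v v0; pose w := U ^t* *m v.
have -> : v ^t* *m udiag p *m v = w ^t* *m cdiag p *m w.
  by rewrite /udiag /w !(trmx_mul, map_mxM) trmxCK !mulmxA.
have w0 : w != 0.
  apply: contraNneq v0 => w0; have : U *m w = 0 by rewrite w0 mulmx0.
  by rewrite /w mulmxA unitary_mul_adj mul1mx => ->.
have [k wk] : exists k, w k 0 != 0.
  apply/existsP; apply: contraNT w0 => /existsPn H; apply/eqP/matrixP => k l.
  by rewrite ord1 [RHS]mxE; apply/eqP; have := H k; rewrite negbK.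
have E : (w ^t* *m cdiag p *m w) 0 0 = \sum_j (p 0 j)%:C * (`|w j 0| ^+ 2).
  rewrite mul_mx_diag !mxE; apply: eq_bigr => j _; rewrite !mxE normCK; ring.
rewrite E (bigD1 k)//= ltr_pwDl//.
  by rewrite mulr_gt0 ?exprn_gt0 ?normr_gt0// ltcR.
by apply: sumr_ge0 => j _; rewrite mulr_ge0 ?exprn_ge0// lecR ltW.
Qed.

Lemma density_udiag p : simplex p -> density_matrix (udiag p).
Proof.
by move=> [p0 p1]; split; [exact: posdef_udiag | rewrite tr_udiag p1].
Qed.

Lemma expm_udiag p : expm (udiag p) = udiag (map_mx (@expR R) p).
Proof.
pose q n : 'rV[R]_c := \row_j \sum_(k < n) (k`!%:R)^-1 * p 0 j ^+ k.
have lim (z : 'I_c -> R) :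
  \sum_j z j * q n 0 j @[n --> \oo] --> \sum_j z j * (map_mx (@expR R) p) 0 j.
  apply: cvg_big => [|j _]; first exact: add_continuous.
  apply: cvgMr; rewrite mxE /expR.
  apply: cvg_trans (is_cvg_series_exp_coeff (p 0 j)).
  apply: near_eq_cvg; near=> n.
  rewrite /q mxE /series /= big_mkord; apply: eq_bigr => k _.
  by rewrite /exp_coeff /= mulrC.
have SE n : \sum_(k < n) (k`!%:R)^-1 *: udiag p ^+ k =
    udiag (q n).
  have -> : q n =
      \sum_(k < n) (k`!%:R)^-1 *: \row_j p 0 j ^+ k.
    by apply/rowP => j; rewrite mxE summxE; apply: eq_bigr => k _; rewrite !mxE.
  rewrite udiag_sum; apply: eq_bigr => k _; rewrite udiagX udiagZ.
  by rewrite fmorphV rmorph_nat.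
apply/matrixP => a b; rewrite mxE.
have -> : udiag (map_mx (@expR R) p) a b =
   complex.Re (udiag (map_mx (@expR R) p) a b) +i*
   complex.Im (udiag (map_mx (@expR R) p) a b) by case: (udiag _ _ _).
congr (_ +i* _); apply/cvg_lim => //; under eq_fun do rewrite SE.
- by under eq_fun do rewrite Re_udiag; rewrite Re_udiag; exact: lim.
- by under eq_fun do rewrite Im_udiag; rewrite Im_udiag; exact: lim.
Unshelve. all: by end_near. Qed.

Lemma qsoftmax_udiag p : qsoftmax (udiag p) = udiag (softmax p).
Proof.
rewrite /qsoftmax expm_udiag tr_udiag -fmorphV -udiagZ; congr udiag.
apply/rowP => j; rewrite !mxE mulrC; congr (_ / _).
by apply: eq_bigr => k _; rewrite mxE.
Qed.

Lemma Rintegral01_cst (a : R) :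
  Rintegral lebesgue_measure `[0, 1] (fun=> a) = a :> R.
Proof.
rewrite Rintegral_cst//= lebesgue_measure_itv/= lte_fin ltr01.
by rewrite -EFinD subr0 /= mulr1.
Qed.

(** The integrand is constant: p^(1-l) p^l = p. *)
Lemma Tinv_udiag p y : (forall j, 0 < p 0 j) ->
  Tinv (udiag p) (udiag y) = udiag (\row_j (p 0 j * y 0 j)).
Proof.
move=> p0.
have E l : powm (udiag p) (1 - l) *m udiag y *m powm (udiag p) l =
    udiag (\row_j (p 0 j * y 0 j)).
  rewrite /powm !hfun_diag// !udiagM; congr udiag; apply/rowP => j; rewrite !mxE.
  rewrite mulrAC -powRD ?subrK ?powRr1//; first exact: ltW.
  by rewrite oner_eq0.
apply/matrixP => a b; rewrite mxE.
under eq_Rintegral do rewrite E.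
under [X in _ +i* X]eq_Rintegral do rewrite E.
by rewrite !Rintegral01_cst; case: (udiag _ a b).
Qed.

Lemma qreplicator_udiag p y : simplex p ->
  qreplicator (udiag p) (udiag y) = udiag (replicate p y).
Proof.
move=> [p0 p1]; rewrite /qreplicator /inner Tinv_udiag// udiagM tr_udiag.
rewrite -udiagZ -udiagN -udiagD; congr udiag; apply/rowP => j.
rewrite replicateE !mxE mulrBr; congr (_ - _); rewrite mulrC; congr (_ * _).
by apply: eq_bigr => k _; rewrite mxE.
Qed.

Section CommutingFlow.
Variables (V : finType) (G : weighted_graph R V).

Lemma qOmega_udiag (S : V -> 'rV[R]_c) i :
  qOmega G (fun k => udiag (S k)) i = udiag (Omega G S i).
Proof. by rewrite /qOmega udiag_sum; apply: eq_bigr => k _; rewrite udiagZ. Qed.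

(** The logarithm of the barycenter is a multiple of the identity, which the
normalisation of the exponential cancels. *)
Lemma qsimilarity_udiag (D : V -> 'M[R[i]]_c) (lambda : V -> 'rV[R]_c) i :
  (0 < c)%N -> (forall k, D k = udiag (lambda k)) ->
  qsimilarity G D (@qbarycenter R V c) i = udiag (similarity G lambda (@barycenter R V c) i).
Proof.
move=> c0 DE; rewrite similarity_barycenter// /qsimilarity.
have -> : \sum_(k in nbhd G i) (weight G i k)%:C *: (logm (@qbarycenter R V c k) - D k) =
   udiag (- (\sum_(k in nbhd G i) weight G i k *: lambda k)
     + const_mx (\sum_(k in nbhd G i) weight G i k * ln c%:R^-1)).
  have -> : - (\sum_(k in nbhd G i) weight G i k *: lambda k)
     + const_mx (\sum_(k in nbhd G i) weight G i k * ln c%:R^-1) =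
     \sum_(k in nbhd G i) weight G i k *: (const_mx (ln c%:R^-1) - lambda k).
    apply/rowP => j; rewrite !mxE !summxE -sumrN -big_split/=.
    by apply: eq_bigr => k _; rewrite !mxE; ring.
  rewrite udiag_sum; apply: eq_bigr => k _; rewrite udiagZ udiagD udiagN DE.
  congr (_ *: (_ - _)); rewrite /logm /qbarycenter.
  have -> : (c%:R^-1)%:M = udiag (const_mx c%:R^-1).
    by rewrite udiag_const fmorphV rmorph_nat.
  by rewrite hfun_diag// map_const_mx.
rewrite qsoftmax_udiag; congr udiag.
by rewrite -!(tilt_const _ (oner_neq0 R)) tilt_shift.
Qed.

Lemma qsaf_udiag D lambda (S : R -> V -> 'rV[R]_c) :
  (0 < c)%N -> (forall k, D k = udiag (lambda k)) ->
  af_solution G lambda S -> qsaf_solution G D (fun t i => udiag (S t i)).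
Proof.
move=> c0 DE [HS S0]; split; last first.
  by apply/funext => i; rewrite (qsimilarity_udiag _ c0 DE) -S0.
move=> t t0; have [mS dS] := HS t t0; split=> [i|i a b].
  exact: density_udiag.
rewrite qOmega_udiag qreplicator_udiag//=; split.
- rewrite Re_udiag; under eq_fun do rewrite Re_udiag.
  by apply: deriv_ge0_sum => j _; apply: deriv_ge0Z.
- rewrite Im_udiag; under eq_fun do rewrite Im_udiag.
  by apply: deriv_ge0_sum => j _; apply: deriv_ge0Z.
Qed.

End CommutingFlow.
End UnitaryDiagonal.

(** * An entrywise matrix norm *)

Section EntrywiseNorm.
Variable R : realType.
Notation normc := Normc.normc.
Implicit Types z : R[i].

Lemma normc_ge0 z : 0 <= normc z. Proof. by case: z => a b; exact: sqrtr_ge0. Qed.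

Lemma normc_real (x : R) : normc x%:C = `|x|.
Proof. by rewrite /= expr0n addr0 sqrtr_sqr. Qed.

Lemma ler_Re_normc z : `|complex.Re z| <= normc z.
Proof. by case: z => a b /=; rewrite -sqrtr_sqr ler_wsqrtr// lerDl sqr_ge0. Qed.

Lemma ler_Im_normc z : `|complex.Im z| <= normc z.
Proof. by case: z => a b /=; rewrite -sqrtr_sqr ler_wsqrtr// lerDr sqr_ge0. Qed.

Lemma normc_le_ReIm z : normc z <= `|complex.Re z| + `|complex.Im z|.
Proof.
case: z => a b /=; rewrite -(ler_pXn2r (n := 2))// ?nnegrE ?sqrtr_ge0 ?addr_ge0//.
rewrite sqr_sqrtr ?addr_ge0 ?sqr_ge0// sqrrD !real_normK ?num_real//.
by rewrite addrAC lerDl mulrn_wge0// mulr_ge0.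
Qed.

Lemma ler_normc_sum (I : Type) (r : seq I) (P : pred I) (f : I -> R[i]) :
  normc (\sum_(i <- r | P i) f i) <= \sum_(i <- r | P i) normc (f i).
Proof.
elim/big_rec2 : _ => [|i x y _ h]; first by rewrite Normc.normc0.
by apply: le_trans (le_normcD _ _) _; rewrite lerD2l.
Qed.

(** Any submultiplicative norm serves; for the entrywise l^1 norm,
submultiplicativity is a rearrangement of sums. *)
Definition mxnorm1 m n (A : 'M[R[i]]_(m, n)) : R := \sum_a \sum_b normc (A a b).

Lemma mxnorm1_ge0 m n (A : 'M[R[i]]_(m, n)) : 0 <= mxnorm1 A.
Proof. by apply: sumr_ge0 => a _; apply: sumr_ge0 => b _; exact: normc_ge0. Qed.

Lemma mxnorm1_entry m n (A : 'M[R[i]]_(m, n)) a b : normc (A a b) <= mxnorm1 A.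
Proof.
rewrite /mxnorm1 (bigD1 a)//= (bigD1 b)//= -addrA lerDl addr_ge0//.
  by apply: sumr_ge0 => ? _; exact: normc_ge0.
by apply: sumr_ge0 => ? _; apply: sumr_ge0 => ? _; exact: normc_ge0.
Qed.

Lemma mxnorm10 m n : mxnorm1 (0 : 'M[R[i]]_(m, n)) = 0.
Proof.
by apply: big1 => a _; apply: big1 => b _; rewrite mxE; exact: Normc.normc0.
Qed.

Lemma mxnorm1D m n (A B : 'M[R[i]]_(m, n)) :
  mxnorm1 (A + B) <= mxnorm1 A + mxnorm1 B.
Proof.
rewrite /mxnorm1 -big_split/=; apply: ler_sum => a _; rewrite -big_split/=.
by apply: ler_sum => b _; rewrite mxE; exact: le_normcD.
Qed.

Lemma mxnorm1_sum m n (I : Type) (r : seq I) (P : pred I) (f : I -> 'M[R[i]]_(m, n)) :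
  mxnorm1 (\sum_(i <- r | P i) f i) <= \sum_(i <- r | P i) mxnorm1 (f i).
Proof.
elim/big_rec2 : _ => [|i x y _ h]; first by rewrite mxnorm10.
by apply: le_trans (mxnorm1D _ _) _; rewrite lerD2l.
Qed.

Lemma mxnorm1Z m n (z : R[i]) (A : 'M[R[i]]_(m, n)) :
  mxnorm1 (z *: A) = normc z * mxnorm1 A.
Proof.
rewrite /mxnorm1 mulr_sumr; apply: eq_bigr => a _; rewrite mulr_sumr.
by apply: eq_bigr => b _; rewrite mxE Normc.normcM.
Qed.

Lemma mxnorm1M m n p (A : 'M[R[i]]_(m, n)) (B : 'M[R[i]]_(n, p)) :
  mxnorm1 (A *m B) <= mxnorm1 A * mxnorm1 B.
Proof.
rewrite /mxnorm1 mulr_suml; apply: ler_sum => a _.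
apply: (@le_trans _ _ (\sum_b \sum_k normc (A a k) * normc (B k b))).
  apply: ler_sum => b _; rewrite mxE; apply: le_trans (ler_normc_sum _ _ _) _.
  by apply: ler_sum => k _; rewrite Normc.normcM.
rewrite exchange_big/= mulr_suml; apply: ler_sum => k _.
rewrite -mulr_sumr ler_wpM2l ?normc_ge0// [leRHS](bigD1 k)//= lerDl.
by apply: sumr_ge0 => ? _; apply: sumr_ge0 => ? _; exact: normc_ge0.
Qed.

Lemma mxnorm1M3 m n p q (A : 'M[R[i]]_(m, n)) (B : 'M[R[i]]_(n, p))
    (C : 'M[R[i]]_(p, q)) (x y z : R) :
  mxnorm1 A <= x -> mxnorm1 B <= y -> mxnorm1 C <= z ->
  mxnorm1 (A *m B *m C) <= x * y * z.
Proof.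
move=> Ax By Cz; apply: le_trans (mxnorm1M _ _) _.
apply: ler_pM => //; rewrite ?mxnorm1_ge0//.
by apply: le_trans (mxnorm1M _ _) _; apply: ler_pM; rewrite ?mxnorm1_ge0.
Qed.

Lemma normc_trace n (A : 'M[R[i]]_n) : normc (\tr A) <= mxnorm1 A.
Proof.
apply: le_trans (ler_normc_sum _ _ _) _; apply: ler_sum => a _.
by rewrite (bigD1 a)//= lerDl; apply: sumr_ge0 => ? _; exact: normc_ge0.
Qed.

Lemma normc_unitary n (U : 'M[R[i]]_n) a b : U \is unitarymx -> normc (U a b) <= 1.
Proof.
move=> Uu; have /matrixP/(_ a a) := unitary_mul_adj Uu.
rewrite mxE mxE eqxx => E.
have : \sum_k normc (U a k) ^+ 2 = 1.
  apply: complexI; rewrite rmorph_sum -[RHS]E; apply: eq_bigr => k _.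
  by rewrite !mxE -normCK rmorphXn.
rewrite (bigD1 b)//= => E1.
have : normc (U a b) ^+ 2 <= 1.
  by rewrite -E1 lerDl; apply: sumr_ge0 => ? _; exact: sqr_ge0.
by rewrite -[leRHS](expr1n _ 2) ler_pXn2r ?nnegrE ?normc_ge0.
Qed.

Lemma mxnorm1_unitary n (U : 'M[R[i]]_n) : U \is unitarymx ->
  mxnorm1 U <= n%:R * n%:R.
Proof.
move=> Uu; apply: (@le_trans _ _ (\sum_(a < n) \sum_(b < n) 1)).
  by apply: ler_sum => a _; apply: ler_sum => b _; exact: normc_unitary.
by rewrite !sumr_const !card_ord mulr_natr.
Qed.

Lemma unitary_adj n (U : 'M[R[i]]_n) : U \is unitarymx -> U ^t* \is unitarymx.
Proof. by move=> Uu; apply/unitarymxP; rewrite trmxCK; exact: unitary_adj_mul. Qed.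

End EntrywiseNorm.

(** * Powers of density matrices are Lipschitz at a fixed spectrum *)

Section SpectralLipschitz.
Variables (R : realType) (c : nat).
Notation normc := Normc.normc.
Implicit Types (A B X Y : 'M[R[i]]_c) (p x s : 'rV[R]_c).

Let N : R := c%:R * c%:R.

(** With Q = W^* U one has f(A) - f(B) = W (f(x) Q - Q f(s)) U^*, and the
middle factor has entries (f(x_a) - f(s_b)) Q_ab. The case f = id is A - B
itself. *)
Lemma udiag_lipschitz (U W : 'M[R[i]]_c) x s (f : R -> R) (L : R) :
  U \is unitarymx -> W \is unitarymx ->
  (forall a b, `|f (x 0 a) - f (s 0 b)| <= L * `|x 0 a - s 0 b|) -> 0 <= L ->
  mxnorm1 (udiag W (map_mx f x) - udiag U (map_mx f s)) <=
  L * N ^+ 4 * mxnorm1 (udiag W x - udiag U s).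
Proof.
move=> Uu Wu fL L0; pose Q := W ^t* *m U.
have N0 : 0 <= N by rewrite mulr_ge0.
have Ua := unitary_adj Uu; have Wa := unitary_adj Wu.
have [Z [ZE ZiE ZfE]] : exists Z : (R -> R) -> 'M[R[i]]_c, [/\
    forall g, udiag W (map_mx g x) - udiag U (map_mx g s) = W *m Z g *m U ^t*,
    Z id = W ^t* *m (udiag W x - udiag U s) *m U &
    forall g a b, Z g a b = (g (x 0 a) - g (s 0 b))%:C * Q a b].
  pose Z g : 'M[R[i]]_c := cdiag (map_mx g x) *m Q - Q *m cdiag (map_mx g s).
  have ZE g : udiag W (map_mx g x) - udiag U (map_mx g s) = W *m Z g *m U ^t*.
    rewrite /Z /Q mulmxBr mulmxBl /udiag !mulmxA (unitary_mul_adj Wu) mul1mx.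
    by rewrite -(mulmxA _ U) (unitary_mul_adj Uu) mulmx1.
  exists Z; split=> // [|g a b].
    have idE p : map_mx id p = p by apply/rowP => j; rewrite mxE.
    have := ZE id; rewrite !idE => ->.
    by rewrite !mulmxA (unitary_adj_mul Wu) mul1mx -mulmxA (unitary_adj_mul Uu) mulmx1.
  rewrite /Z mul_diag_mx mul_mx_diag mxE [X in X + _]mxE [X in _ + X]mxE.
  rewrite [X in _ - X]mxE !mxE.
  set q := \sum_k _; rewrite rmorphB; ring.
rewrite ZE.
apply: (@le_trans _ _ (N * (L * (N * mxnorm1 (udiag W x - udiag U s) * N)) * N)).
  apply: mxnorm1M3; [exact: (mxnorm1_unitary Wu)| |exact: (mxnorm1_unitary Ua)].
  apply: (@le_trans _ _ (L * mxnorm1 (Z id))).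
    rewrite /mxnorm1 mulr_sumr; apply: ler_sum => a _; rewrite mulr_sumr.
    apply: ler_sum => b _; rewrite (ZfE f) (ZfE id) !Normc.normcM mulrA.
    apply: ler_wpM2r; first exact: normc_ge0.
    by rewrite (normc_real (f _ - f _)) (normc_real (id _ - id _)).
  apply: ler_wpM2l => //; rewrite ZiE.
  apply: mxnorm1M3; [exact: (mxnorm1_unitary Wa)|exact: lexx|].
  exact: (mxnorm1_unitary Uu).
by rewrite le_eqVlt; apply/predU1P; left; ring.
Qed.

(** With r = x / s, this is |r^l - 1| <= |r - 1|, which holds because r^l lies
between 1 and r. *)
Lemma powR_lipschitz (x s l K : R) : 0 < x -> 0 < s <= 1 -> 0 <= l <= 1 ->
  s^-1 <= K -> `|x `^ l - s `^ l| <= K * `|x - s|.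
Proof.
move=> x0 /andP[s0 s1] /andP[l0 l1] sK; pose r := x / s.
have r0 : 0 < r by rewrite divr_gt0.
have xE : x = r * s by rewrite /r divfK// gt_eqF.
have rl : `|r `^ l - 1| <= `|r - 1|.
  have [r1|/ltW r1] := leP r 1.
    have h1 : r <= r `^ l by apply: ger1_powR => //; rewrite r0.
    have h2 : r `^ l <= 1 by rewrite -(powRr0 r) ger_powR// r0.
    by rewrite !ler0_norm ?subr_le0//; lra.
  have h1 : r `^ l <= r by apply: ler1_powR.
  have h2 : 1 <= r `^ l by rewrite -[leLHS](powRr0 r) ler_powR.
  by rewrite !ger0_norm ?subr_ge0//; lra.
have sl : s `^ l <= 1 by rewrite -(powRr0 s) ger_powR// s0.
rewrite {1}xE (powRM _ (ltW r0) (ltW s0)) -[X in _ - X]mul1r -mulrBl normrM.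
rewrite [`|s `^ l|]ger0_norm ?powR_ge0//.
apply: (@le_trans _ _ (`|r - 1| * 1)).
  by apply: ler_pM => //; exact: powR_ge0.
rewrite mulr1; have -> : r - 1 = s^-1 * (x - s).
  by rewrite /r; field; rewrite gt_eqF.
by rewrite normrM ler_wpM2r// ger0_norm// invr_ge0 ltW.
Qed.

Lemma density_spectral A : density_matrix A ->
  exists W, exists2 x, W \is unitarymx & simplex x /\ A = udiag W x.
Proof.
move=> [[hA pA] tA].
have := orthomx_spectralP (hermitian_normalmx hA).
set P := spectralmx A; set x := spectral_diag A => AE.
have Pu : P \is unitarymx by exact: spectral_unitarymx.
pose W := P ^t*; have Wu : W \is unitarymx by exact: unitary_adj.
pose q := map_mx (@complex.Re R) x.
have xE : x = map_mx (real_complex R) q.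
  have /mxOverP xr := hermitian_spectral_diag_real hA.
  by apply/rowP => j; rewrite !mxE; have /RRe_real := xr 0 j.
have AW : A = udiag W q.
  have WP : W ^t* = P by exact: trmxCK.
  have WV : W = invmx P by rewrite (invmx_unitary Pu).
  have qE : cdiag q = diag_mx x by rewrite /cdiag -xE.
  by rewrite /udiag WP WV qE.
exists W, q => //; split=> //; split=> [k|]; last first.
  by have := tA; rewrite AW tr_udiag// => /complexI.
pose d : 'cV[R[i]]_c := delta_mx k 0.
have WW : W ^t* *m (W *m d) = d by rewrite mulmxA unitary_adj_mul// mul1mx.
have v0 : W *m d != 0.
  apply/eqP => h; have := WW; rewrite h mulmx0 => /matrixP/(_ k 0).
  by rewrite !mxE !eqxx => /esym/eqP; rewrite oner_eq0.
have := pA _ v0; rewrite AW /udiag.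
have -> : (W *m d) ^t* *m (W *m cdiag q *m W ^t*) *m (W *m d) = d ^t* *m cdiag q *m d.
  rewrite -!mulmxA WW !mulmxA; congr (_ *m _ *m _).
  by rewrite !(trmx_mul, map_mxM) -mulmxA unitary_adj_mul// mulmx1.
rewrite mul_mx_diag mxE (bigD1 k)//= big1 => [|j jk].
  by rewrite !mxE !eqxx rmorph1 mul1r mulr1 addr0 ltcR.
by rewrite !mxE (negbTE jk) mulr0.
Qed.

Lemma powm_udiag (U : 'M[R[i]]_c) p (l : R) : U \is unitarymx ->
  powm (udiag U p) l = udiag U (map_mx (fun y => y `^ l) p).
Proof. exact: hfun_diag. Qed.

Lemma mxnorm1_udiag (U : 'M[R[i]]_c) p : U \is unitarymx ->
  (forall j, 0 <= p 0 j <= 1) -> mxnorm1 (udiag U p) <= N * N * N.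
Proof.
move=> Uu p01; apply: mxnorm1M3; [exact: mxnorm1_unitary| |
  by apply: mxnorm1_unitary; exact: unitary_adj].
apply: (@le_trans _ _ (\sum_(a < c) \sum_(b < c) 1)).
  apply: ler_sum => a _; apply: ler_sum => b _; rewrite !mxE.
  have /andP[h0 h1] := p01 a.
  case: eqVneq => _; first by rewrite mulr1n normc_real ger0_norm.
  by rewrite mulr0n Normc.normc0.
by rewrite !sumr_const !card_ord /N mulr_natr.
Qed.

(** Bounds the norm of a density matrix and of its powers: two unitary factors
and a diagonal with entries in [0, 1], each of norm at most N. *)
Let bd : R := N * N * N.

Lemma mxnorm1_density A : density_matrix A -> mxnorm1 A <= bd.
Proof.
move=> /density_spectral[W [x Wu [sx ->]]]; apply: mxnorm1_udiag => // j.
by rewrite simplex_le1// andbT ltW//; case: sx.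
Qed.

Lemma mxnorm1_powm A (l : R) : 0 <= l -> density_matrix A ->
  mxnorm1 (powm A l) <= bd.
Proof.
move=> l0 /density_spectral[W [x Wu [sx ->]]]; rewrite powm_udiag//.
apply: mxnorm1_udiag => // j; rewrite mxE powR_ge0 /=.
have x0 : 0 < x 0 j by case: sx.
by rewrite -(powRr0 (x 0 j)) ger_powR// x0 simplex_le1.
Qed.

Lemma powm_lipschitz A (U : 'M[R[i]]_c) s (l K : R) : density_matrix A ->
  U \is unitarymx -> simplex s -> (forall j, (s 0 j)^-1 <= K) -> 0 <= K ->
  0 <= l <= 1 ->
  mxnorm1 (powm A l - powm (udiag U s) l) <= K * N ^+ 4 * mxnorm1 (A - udiag U s).
Proof.
move=> /density_spectral[W [x Wu [sx ->]]] Uu ss sK K0 l01.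
rewrite (powm_udiag _ _ Wu) (powm_udiag _ _ Uu).
apply: (@udiag_lipschitz U W x s (fun y => y `^ l) K Uu Wu _ K0) => a b.
have [x0 _] := sx; have [s0 _] := ss.
by apply: powR_lipschitz => //; rewrite s0 simplex_le1.
Qed.

End SpectralLipschitz.

(** * Lipschitz estimate of the quantum replicator field *)

Section ReplicatorLipschitz.
Variables (R : realType) (c : nat).
Notation normc := Normc.normc.
Implicit Types (A B X Y : 'M[R[i]]_c) (p x s : 'rV[R]_c).

Let N : R := c%:R * c%:R.
Let bd : R := N * N * N.

Lemma continuous_powR_exponent (x : R) : 0 < x -> continuous (fun l : R => x `^ l).
Proof.
move=> x0; have -> : (fun l : R => x `^ l) = (fun l => expR (l * ln x)).
  by apply/funext => l; rewrite /powR gt_eqF.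
move=> l; apply: (@cvg_comp _ _ _ (fun l : R => l * ln x) (@expR R) _ (nbhs (l * ln x))).
  by apply: cvgMl; exact: cvg_id.
exact: continuous_expR.
Qed.

Definition Tinv_integrand A X (l : R) : 'M[R[i]]_c :=
  powm A (1 - l) *m X *m powm A l.

Lemma Tinv_integrandE (W : 'M[R[i]]_c) x X (l : R) a b : W \is unitarymx ->
  Tinv_integrand (udiag W x) X l a b =
  \sum_k \sum_j (x 0 j `^ (1 - l) * x 0 k `^ l)%:C *
    (W a j * (W ^t* *m X *m W) j k * (W ^t*) k b).
Proof.
move=> Wu; rewrite /Tinv_integrand (powm_udiag _ _ Wu) (powm_udiag _ _ Wu).
set M := W ^t* *m X *m W.
pose p := map_mx (fun y => y `^ (1 - l)) x; pose q := map_mx (fun y => y `^ l) x.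
have -> : udiag W p *m X *m udiag W q = W *m (cdiag p *m M *m cdiag q) *m W ^t*.
  by rewrite /udiag /M !mulmxA.
clearbody M; rewrite mxE; apply: eq_bigr => k _; rewrite mxE mulr_suml.
apply: eq_bigr => j _; rewrite mul_mx_diag mxE mul_diag_mx mxE.
by rewrite /p /q !mxE rmorphM; ring.
Qed.

Lemma continuous_Tinv_integrand A X a b : density_matrix A ->
  continuous (fun l => complex.Re (Tinv_integrand A X l a b)) /\
  continuous (fun l => complex.Im (Tinv_integrand A X l a b)).
Proof.
move=> /density_spectral[W [x Wu [[x0 _] ->]]].
have key (z : 'I_c -> 'I_c -> R) : continuous (fun l : R =>
    \sum_k \sum_j (x 0 j `^ (1 - l) * x 0 k `^ l) * z k j).
  move=> l; apply: cvg_big => [|k _]; first exact: add_continuous.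
  apply: cvg_big => [|j _]; first exact: add_continuous.
  apply: cvgMl; apply: cvgM; last exact: continuous_powR_exponent.
  apply: (@cvg_comp _ _ _ (fun l : R => 1 - l) (fun l : R => x 0 j `^ l) _ (nbhs (1 - l))).
    by apply: cvgB; [exact: cvg_cst|exact: cvg_id].
  exact: continuous_powR_exponent.
split.
- under eq_fun do (rewrite Tinv_integrandE// Re_sum; under eq_bigr do
    (rewrite Re_sum; under eq_bigr do rewrite Re_realM)).
  exact: key.
- under eq_fun do (rewrite Tinv_integrandE// Im_sum; under eq_bigr do
    (rewrite Im_sum; under eq_bigr do rewrite Im_realM)).
  exact: key.
Qed.

Lemma complex_eta (z : R[i]) : z = complex.Re z +i* complex.Im z.
Proof. by case: z. Qed.

(** The entries of [Tinv] as integrals of abstract continuous functions: later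
estimates then involve no matrix under the integral sign. *)
Lemma Tinv_entry A X a b : density_matrix A ->
  exists f g : R -> R, [/\ continuous f, continuous g,
    Tinv A X a b = Rintegral lebesgue_measure `[0, 1] f +i*
                   Rintegral lebesgue_measure `[0, 1] g &
    forall l, Tinv_integrand A X l a b = f l +i* g l].
Proof.
move=> dA; exists (fun l => complex.Re (Tinv_integrand A X l a b)).
exists (fun l => complex.Im (Tinv_integrand A X l a b)).
have [cf cg] := continuous_Tinv_integrand X a b dA.
split; [exact: cf|exact: cg|by rewrite [LHS]mxE|by move=> l; exact: complex_eta].
Qed.

Lemma Rintegral01_dist (f g : R -> R) (E : R) : continuous f -> continuous g ->
  (forall l, 0 <= l <= 1 -> `|f l - g l| <= E) ->
  `|Rintegral lebesgue_measure `[0, 1] f -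
    Rintegral lebesgue_measure `[0, 1] g| <= E.
Proof.
move=> cf cg fgE.
have I (h : R -> R) : continuous h ->
    lebesgue_measure.-integrable `[0 : R, 1] (EFin \o h).
  move=> ch; apply: continuous_compact_integrable; first exact: segment_compact.
  exact: continuous_subspaceT.
have cfg : continuous (fun l => f l - g l) by move=> l; apply: cvgB; [exact: cf|exact: cg].
rewrite -RintegralB//; [|exact: I|exact: I].
apply: le_trans (le_normr_Rintegral _ _) _ => //; first exact: I.
rewrite -[leRHS]Rintegral01_cst; apply: le_Rintegral => //.
- by apply: I => l; apply: cvg_norm; exact: cfg.
- by apply: I => l; exact: cvg_cst.
Qed.

Lemma complex_integral_dist (u v : R[i]) (f g f' g' : R -> R) (E : R) :
  continuous f -> continuous g -> continuous f' -> continuous g' ->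
  u = Rintegral lebesgue_measure `[0, 1] f +i* Rintegral lebesgue_measure `[0, 1] g ->
  v = Rintegral lebesgue_measure `[0, 1] f' +i* Rintegral lebesgue_measure `[0, 1] g' ->
  (forall l, 0 <= l <= 1 -> normc ((f l +i* g l) - (f' l +i* g' l)) <= E) ->
  `|complex.Re u - complex.Re v| <= E /\ `|complex.Im u - complex.Im v| <= E.
Proof.
move=> cf cg cf' cg' -> -> H.
split; [apply: (Rintegral01_dist cf cf')|apply: (Rintegral01_dist cg cg')] => l l01;
  apply: le_trans (H l l01).
- exact: (ler_Re_normc (_ +i* _ - _ +i* _)).
- exact: (ler_Im_normc (_ +i* _ - _ +i* _)).
Qed.

Lemma Tinv_dist A B X Y (E : R) a b : density_matrix A -> density_matrix B ->
  (forall l, 0 <= l <= 1 ->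
    mxnorm1 (Tinv_integrand A X l - Tinv_integrand B Y l) <= E) ->
  `|complex.Re (Tinv A X a b) - complex.Re (Tinv B Y a b)| <= E /\
  `|complex.Im (Tinv A X a b) - complex.Im (Tinv B Y a b)| <= E.
Proof.
move=> dA dB H.
have [f [g [cf cg eA FA]]] := Tinv_entry X a b dA.
have [f' [g' [cf' cg' eB FB]]] := Tinv_entry Y a b dB.
apply: (complex_integral_dist cf cg cf' cg' eA eB) => l l01.
apply: le_trans (H l l01); move: (FA l) (FB l).
move: (Tinv_integrand A X l) (Tinv_integrand B Y l) => M M' <- <-.
by have := mxnorm1_entry (M - M') a b; rewrite mxE [X in _ + X]mxE.
Qed.

Lemma telescope3 (M : zmodType) (x y z w : M) :
  x - w = (x - y) + ((y - z) + (z - w)).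
Proof. by rewrite !subrKA. Qed.

Lemma complex_dist_sub (t t' n n' : R[i]) (E1 E2 : R) :
  `|complex.Re t - complex.Re t'| <= E1 /\ `|complex.Im t - complex.Im t'| <= E1 ->
  normc (n - n') <= E2 ->
  `|complex.Re (t - n) - complex.Re (t' - n')| <= E1 + E2 /\
  `|complex.Im (t - n) - complex.Im (t' - n')| <= E1 + E2.
Proof.
move=> [r1 i1] nE; have r2 := le_trans (ler_Re_normc _) nE.
have i2 := le_trans (ler_Im_normc _) nE.
case: t t' n n' r1 i1 r2 i2 {nE} => [a b] [a' b'] [d e] [d' e'] /= r1 i1 r2 i2.
have E (x y z w : R) : x - z - (y - w) = (x - y) - (z - w) by ring.
by rewrite (E a a') (E b b'); split; apply: le_trans (ler_normB _ _) (lerD _ _).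
Qed.

(** Two changed powers and one changed X in [Tinv]; A changed twice and X
once in the scalar multiple of A. *)
Definition replicator_lip (K : R) : R :=
  2 * (K * N ^+ 4) * (bd * bd) + 4 * (bd * bd).

Lemma replicator_lip_ge0 K : 0 <= K -> 0 <= replicator_lip K.
Proof. by move=> K0; rewrite addr_ge0 ?mulr_ge0 ?exprn_ge0. Qed.

(** Both terms of R_rho[X] are products in which one factor is changed at a
time. Only the eigenvalues s of the diagonal point enter the constant, through
the bound K on their inverses. *)
Lemma qreplicator_lipschitz A (U : 'M[R[i]]_c) s X Y (K D : R) a b :
  density_matrix A -> U \is unitarymx -> simplex s ->
  (forall j, (s 0 j)^-1 <= K) -> 0 <= K ->
  mxnorm1 X <= bd -> mxnorm1 Y <= bd ->
  mxnorm1 (A - udiag U s) <= D -> mxnorm1 (X - Y) <= D ->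
  `|complex.Re (qreplicator A X a b) - complex.Re (qreplicator (udiag U s) Y a b)|
    <= replicator_lip K * D /\
  `|complex.Im (qreplicator A X a b) - complex.Im (qreplicator (udiag U s) Y a b)|
    <= replicator_lip K * D.
Proof.
move=> dA Uu ss sK K0 Xb Yb; set B := udiag U s => AB XY.
have dB : density_matrix B by exact: density_udiag.
have D0 : 0 <= D by apply: le_trans AB; exact: mxnorm1_ge0.
have bd0 : 0 <= bd by rewrite !mulr_ge0.
have N4 : 0 <= N ^+ 4 by rewrite exprn_ge0// mulr_ge0.
pose E1 : R := 2 * (K * N ^+ 4) * (bd * bd) * D + bd * bd * D.
pose E2 : R := 3 * (bd * bd) * D.
have EE : replicator_lip K * D = E1 + E2 by rewrite /replicator_lip /E1 /E2; ring.
have H1 l : 0 <= l <= 1 ->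
    mxnorm1 (Tinv_integrand A X l - Tinv_integrand B Y l) <= E1.
  move=> /andP[l0 l1]; rewrite /Tinv_integrand.
  have l0' : 0 <= 1 - l by lra.
  have l1' : 1 - l <= 1 by lra.
  have P u : 0 <= u -> u <= 1 -> mxnorm1 (powm A u - powm B u) <= K * N ^+ 4 * D.
    move=> u0 u1; apply: le_trans (powm_lipschitz dA Uu ss sK K0 _) _.
      by rewrite u0.
    by apply: ler_wpM2l => //; rewrite mulr_ge0.
  have := mxnorm1M3 (P _ l0' l1') Xb (mxnorm1_powm l0 dA).
  have := mxnorm1M3 (mxnorm1_powm l0' dB) XY (mxnorm1_powm l0 dA).
  have := mxnorm1M3 (mxnorm1_powm l0' dB) Yb (P _ l0 l1).
  move: (powm A l) (powm B l) (powm A (1 - l)) (powm B (1 - l)) => A1 B1 A2 B2 h3 h2 h1.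
  have -> : A2 *m X *m A1 - B2 *m Y *m B1 = (A2 - B2) *m X *m A1 +
      (B2 *m (X - Y) *m A1 + B2 *m Y *m (A1 - B1)).
    rewrite !(mulmxBl, mulmxBr); exact: telescope3.
  apply: le_trans (mxnorm1D _ _) _.
  apply: le_trans (lerD h1 (le_trans (mxnorm1D _ _) (lerD h2 h3))) _.
  by rewrite /E1 -/bd le_eqVlt; apply/predU1P; left; ring.
have H2 : normc (inner A X * A a b - inner B Y * B a b) <= E2.
  have Ab := le_trans (mxnorm1_entry A a b) (mxnorm1_density dA).
  have Bn := mxnorm1_density dB.
  have ABe : normc (A a b - B a b) <= D.
    apply: le_trans AB; have := mxnorm1_entry (A - B) a b.
    by rewrite mxE [X in _ + X]mxE.
  have t1 : normc (\tr ((A - B) *m X)) <= D * bd.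
    apply: le_trans (normc_trace _) (le_trans (mxnorm1M _ _) _).
    by apply: ler_pM => //; exact: mxnorm1_ge0.
  have t2 : normc (\tr (B *m (X - Y))) <= bd * D.
    apply: le_trans (normc_trace _) (le_trans (mxnorm1M _ _) _).
    by apply: ler_pM => //; exact: mxnorm1_ge0.
  have t3 : normc (\tr (B *m Y)) <= bd * bd.
    apply: le_trans (normc_trace _) (le_trans (mxnorm1M _ _) _).
    by apply: ler_pM => //; exact: mxnorm1_ge0.
  have -> : inner A X * A a b - inner B Y * B a b =
      \tr ((A - B) *m X) * A a b +
      (\tr (B *m (X - Y)) * A a b + \tr (B *m Y) * (A a b - B a b)).
    by rewrite /inner mulmxBl mulmxBr !raddfB /=; ring.
  apply: le_trans (le_normcD _ _) _; rewrite Normc.normcM.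
  have e1 : normc (\tr ((A - B) *m X)) * normc (A a b) <= D * bd * bd.
    by apply: ler_pM => //; exact: normc_ge0.
  have e2 : normc (\tr (B *m (X - Y))) * normc (A a b) <= bd * D * bd.
    by apply: ler_pM => //; exact: normc_ge0.
  have e3 : normc (\tr (B *m Y)) * normc (A a b - B a b) <= bd * bd * D.
    by apply: ler_pM => //; exact: normc_ge0.
  apply: le_trans (lerD e1 (le_trans (le_normcD _ _) _)) _.
    by rewrite !Normc.normcM; exact: lerD e2 e3.
  by rewrite /E2 le_eqVlt; apply/predU1P; left; ring.
have QE M Z : qreplicator M Z a b = Tinv M Z a b - inner M Z * M a b.
  by rewrite /qreplicator mxE [X in _ + X]mxE [X in _ - X]mxE.
rewrite EE !QE; apply: complex_dist_sub H2.
exact: Tinv_dist dA dB H1.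
Qed.

End ReplicatorLipschitz.

(** * Uniqueness of the quantum flow *)

Section Uniqueness.
Variables (R : realType) (V : finType) (G : weighted_graph R V) (c : nat).
Implicit Types (mu D : V -> 'M[R[i]]_c).

Let bd : R := (c%:R * c%:R) * (c%:R * c%:R) * (c%:R * c%:R).

Lemma mxnorm1_qOmega_wsum mu i :
  mxnorm1 (qOmega G mu i) <= \sum_(k in nbhd G i) weight G i k * mxnorm1 (mu k).
Proof.
apply: le_trans (mxnorm1_sum _ _ _) _; apply: ler_sum => k _.
by rewrite mxnorm1Z normc_real ger0_norm ?weight_ge0.
Qed.

Lemma mxnorm1_qOmega_density mu i : qmanifold mu -> mxnorm1 (qOmega G mu i) <= bd.
Proof.
move=> dmu; apply: le_trans (mxnorm1_qOmega_wsum _ _) _.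
rewrite -[leRHS]mul1r -(weight_nbhd_sum G i) mulr_suml; apply: ler_sum => k _.
by rewrite ler_wpM2l ?weight_ge0//; exact: mxnorm1_density.
Qed.

Lemma mxnorm1_qOmega_sub mu nu i :
  mxnorm1 (qOmega G mu i - qOmega G nu i) <= \sum_k mxnorm1 (mu k - nu k).
Proof.
have -> : qOmega G mu i - qOmega G nu i = qOmega G (fun k => mu k - nu k) i.
  by rewrite /qOmega -sumrB; apply: eq_bigr => k _; rewrite scalerBr.
apply: le_trans (mxnorm1_qOmega_wsum _ _) _.
rewrite [leRHS](bigID (mem (nbhd G i)))/=.
apply: ler_wpDr; first by apply: sumr_ge0 => k _; exact: mxnorm1_ge0.
apply: ler_sum => k ki; apply: ler_piMl; first exact: mxnorm1_ge0.
rewrite -(weight_nbhd_sum G i) (bigD1 k)//= lerDl.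
by apply: sumr_ge0 => l _; exact: weight_ge0.
Qed.

Lemma inv_bounded (f df : R -> R) (T : R) : 0 <= T ->
  (forall t, 0 <= t -> deriv_ge0 f t (df t)) -> (forall t, 0 <= t -> 0 < f t) ->
  {K : R | 0 <= K /\ forall t, 0 <= t <= T -> (f t)^-1 <= K}.
Proof.
move=> T0 fd f0; apply: cid.
have [t0 + H] := EVT_min T0 (within_continuous_ge0 fd).
rewrite in_itv/= => /andP[t00 _]; exists (f t0)^-1; split.
  by rewrite invr_ge0 ltW// f0.
move=> t /andP[ht tT]; rewrite lef_pV2 ?posrE ?f0//.
by apply: H; rewrite in_itv/= ht.
Qed.

Lemma sum_pair (I J : finType) (F : I * J -> R) :
  \sum_p F p = \sum_i \sum_j F (i, j).
Proof. by rewrite pair_bigA; apply: eq_bigr => -[]. Qed.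

(** The real and imaginary parts of all the entries of mu - udiag U S satisfy
the hypothesis of [gronwall_eq0], with a constant valid on [0, T]. *)
Lemma qsaf_unique (U : 'M[R[i]]_c) D (S dS : R -> V -> 'rV[R]_c)
    (mu : R -> V -> 'M[R[i]]_c) (T : R) : U \is unitarymx ->
  (forall t, 0 <= t -> manifold (S t)) ->
  (forall t i j, 0 <= t -> deriv_ge0 (fun s => S s i 0 j) t (dS t i 0 j)) ->
  qsaf_solution G D (fun t i => udiag U (S t i)) -> qsaf_solution G D mu ->
  0 <= T -> forall i, mu T i = udiag U (S T i).
Proof.
move=> Uu mS Sd [nuD nu0] [muD mu0] T0 i.
pose nu t i := udiag U (S t i).
have KK k j := inv_bounded T0 (fun t => Sd t k j) (fun t t0 => (mS t t0 k).1 j).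
pose K := \sum_k \sum_j sval (KK k j).
have K0 : 0 <= K.
  by apply: sumr_ge0 => k _; apply: sumr_ge0 => j _; case: (svalP (KK k j)).
have SK t k j : 0 <= t <= T -> (S t k 0 j)^-1 <= K.
  move=> tT; have [_ /(_ t tT) h] := svalP (KK k j); apply: le_trans h _.
  rewrite /K (bigD1 k)//= (bigD1 j)//= -addrA lerDl addr_ge0//.
    by apply: sumr_ge0 => l _; case: (svalP (KK k l)).
  by apply: sumr_ge0 => m _; apply: sumr_ge0 => l _; case: (svalP (KK m l)).
pose part (b : bool) (z : R[i]) : R := if b then complex.Re z else complex.Im z.
pose I := (V * ('I_c * ('I_c * bool)))%type.
pose F (m : V -> 'M[R[i]]_c) k := qreplicator (m k) (qOmega G m k).
pose y (e : I) (t : R) := let: (k, (a, (b, r))) := e in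
  part r (mu t k a b) + -1 * part r (nu t k a b).
pose dy (e : I) (t : R) := let: (k, (a, (b, r))) := e in
  part r (F (mu t) k a b) + -1 * part r (F (nu t) k a b).
have yE t : \sum_k mxnorm1 (mu t k - nu t k) <= \sum_e `|y e t|.
  rewrite sum_pair; apply: ler_sum => k _; rewrite sum_pair.
  apply: ler_sum => a _; rewrite sum_pair; apply: ler_sum => b _.
  rewrite big_bool /y /part.
  have -> : (mu t k - nu t k) a b = mu t k a b - nu t k a b.
    by rewrite mxE [X in _ + X]mxE.
  move: (mu t k a b) (nu t k a b) => u v.
  apply: le_trans (normc_le_ReIm _) _.
  by case: u v => [u u'] [v v'] /=; rewrite !mulN1r.
have y0 : forall e, y e 0 = 0.
  move=> [k [a [b r]]]; rewrite /y.
  have -> : mu 0 k = nu 0 k by rewrite mu0 -nu0.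
  by rewrite mulN1r subrr.
suff yT e : y e T = 0.
  apply/matrixP => a b; rewrite -/(nu T i).
  have := yT (i, (a, (b, true))); have := yT (i, (a, (b, false))).
  rewrite /y /part; move: (mu T i a b) (nu T i a b) => [u u'] [v v'] /=.
  by rewrite !mulN1r => /subr0_eq -> /subr0_eq ->.
apply: (@gronwall_eq0 _ I y dy (replicator_lip c K) T T0 _ _ y0).
  move=> [k [a [b r]]] t t0; have [_ /(_ k a b)[m1 m2]] := muD t t0.
  have [_ /(_ k a b)[n1 n2]] := nuD t t0.
  by rewrite /y /dy; case: r; apply: deriv_ge0D => //; apply: deriv_ge0Z.
move=> [k [a [b r]]] t t0 tT; have {}t0 := ltW t0.
apply: (@le_trans _ _ (replicator_lip c K * \sum_k mxnorm1 (mu t k - nu t k))); last first.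
  by apply: ler_wpM2l; [exact: replicator_lip_ge0|exact: yE].
have [dmu _] := muD t t0; have [dnu _] := nuD t t0.
have dk : mxnorm1 (mu t k - nu t k) <= \sum_k mxnorm1 (mu t k - nu t k).
  rewrite [leRHS](bigD1 k)//= lerDl.
  by apply: sumr_ge0 => ? _; exact: mxnorm1_ge0.
have sK j : (S t k 0 j)^-1 <= K by apply: SK; rewrite t0 ltW.
have [h1 h2] := qreplicator_lipschitz a b (dmu k) Uu (mS t t0 k) sK K0
  (mxnorm1_qOmega_density k dmu) (mxnorm1_qOmega_density k dnu) dk
  (mxnorm1_qOmega_sub (mu t) (nu t) k).
by rewrite /dy /part; case: r; rewrite mulN1r.
Qed.

End Uniqueness.

Theorem corollary4p22 (R : realType) (V : finType) (G : weighted_graph R V)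
    (c : nat) (c_gt0 : (0 < c)%N)
    (U : 'M[R[i]]_c) (U_unitary : U \is unitarymx)
    (D : V -> 'M[R[i]]_c) (lambda : V -> 'rV[R]_c)
    (D_diag : forall i, D i = U *m cdiag (lambda i) *m U ^t*) :
  (exists S : R -> V -> 'rV[R]_c, af_solution G lambda S) /\
  (forall S : R -> V -> 'rV[R]_c, af_solution G lambda S ->
     qsaf_solution G D (fun t i => U *m cdiag (S t i) *m U ^t*) /\
     forall mu : R -> V -> 'M[R[i]]_c, qsaf_solution G D mu ->
       forall t : R, 0 <= t -> forall i, mu t i = U *m cdiag (S t i) *m U ^t*).
Proof.
split; first exact: af_exists.
move=> S HS; have qS := qsaf_udiag U_unitary c_gt0 D_diag HS.
split; first exact: qS.
move=> mu Hmu t t0 i; have [H _] := HS.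
pose dS s k := replicate (S s k) (Omega G (S s) k).
have mS s : 0 <= s -> manifold (S s) by move=> s0; have [] := H s s0.
have Sd s k j : 0 <= s -> deriv_ge0 (fun r => S r k 0 j) s (dS s k 0 j).
  by move=> s0; have [_] := H s s0; apply.
exact: (qsaf_unique U_unitary mS Sd qS Hmu t0).
Qed.
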